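(* Let $\mu$ be a probability measure on $\mathbf{R}^d$ and let $a>0$. The following are equivalent: (1) There exist constants $r_o,b\ge 0$ such that for every integer $n\ge1$, every measurable $A\subset(\mathbf{R}^d)^n$ with $\mu^n(A)\ge 1/2$ and every $r\ge r_o$, \[\mu^n(A+rB_2)\ge 1-b\,e^{-a(r-r_o)^2},\] where $B_2$ is the Euclidean unit ball of $(\mathbf{R}^d)^n$. (2) $\mu$ satisfies $\mathbf{T}_2(1/a)$, i.e. $\mathcal{T}_2(\nu,\mu)\le \frac1a\,H(\nu\,|\,\mu)$ for every probability measure $\nu$ on $\mathbf{R}^d$.
   Context: $\mu^n$ denotes the $n$-fold product measure. For probability measures $\nu,\mu$ on $\mathbf{R}^d$, $\mathcal{T}_2(\nu,\mu)=\inf_\pi\int|x-y|_2^2\,d\pi(x,y)$, the infimum over all couplings $\pi$ of $\nu$ and $\mu$ (probability measures on $\mathbf{R}^d\times\mathbf{R}^d$ with marginals $\nu$ and $\mu$). The relative entropy is $H(\nu\,|\,\mu)=\int\log\frac{d\nu}{d\mu}\,d\nu$ if $\nu\ll\mu$ and $+\infty$ otherwise. *)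

(* Defs.v *)
From HB Require Import structures.
From mathcomp Require Import all_boot all_order all_algebra.
From mathcomp Require Import all_classical all_reals all_analysis.
Set Implicit Arguments.
Unset Strict Implicit.
Unset Printing Implicit Defensive.
Import Order.TTheory GRing.Theory Num.Theory.
Import numFieldNormedType.Exports.
Local Open Scope classical_set_scope.
Local Open Scope ring_scope.

(* Points of R^d are d-tuples of reals; d.-tuple R carries the product
   sigma-algebra (= Borel sigma-algebra of R^d); (R^d)^n is n.-tuple (d.-tuple R). *)

Definition sqdist (R : realType) (d : nat) (x y : d.-tuple R) : R :=
  \sum_(j < d) (tnth x j - tnth y j) ^+ 2.

Definition sqdistn (R : realType) (d n : nat) (x y : n.-tuple (d.-tuple R)) : R :=
  \sum_(i < n) sqdist (tnth x i) (tnth y i).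

(* A + r B_2, B_2 the closed Euclidean unit ball of (R^d)^n  (r >= 0) *)
Definition enlargement (R : realType) (d n : nat)
  (A : set (n.-tuple (d.-tuple R))) (r : R) : set (n.-tuple (d.-tuple R)) :=
  [set z | exists2 x, A x & sqdistn z x <= r ^+ 2].

(* outer measure (= completed measure on universally measurable sets) *)
Definition outer dd (T : measurableType dd) (R : realType)
  (P : set T -> \bar R) (S : set T) : \bar R :=
  ereal_inf [set P B | B in [set B | measurable B /\ S `<=` B]].

Definition is_product_measure (R : realType) (d n : nat)
  (mu : probability (d.-tuple R) R) (P : probability (n.-tuple (d.-tuple R)) R) :=
  forall A : 'I_n -> set (d.-tuple R), (forall i, measurable (A i)) ->
    P [set x | forall i, A i (tnth x i)] = (\prod_(i < n) mu (A i))%E.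

Definition is_coupling (R : realType) (d : nat) (nu mu : probability (d.-tuple R) R)
  (pi : probability (d.-tuple R * d.-tuple R)%type R) :=
  forall A : set (d.-tuple R), measurable A ->
    pi (A `*` setT) = nu A /\ pi (setT `*` A) = mu A.

Definition transport_cost2 (R : realType) (d : nat) (nu mu : probability (d.-tuple R) R)
  : \bar R :=
  ereal_inf [set (\int[pi]_z (sqdist z.1 z.2)%:E)%E
            | pi in [set pi | is_coupling nu mu pi]].

Definition relative_entropy (R : realType) (d : nat) (nu mu : probability (d.-tuple R) R)
  : \bar R :=
  if pselect (nu `<< mu) then
    (\int[nu]_x (ln (fine (Radon_Nikodym_SigmaFinite.f nu mu x)))%:E)%E
  else +oo%E.

(* Main.v *)
Require Import Defs.
From HB Require Import structures.
From mathcomp Require Import all_boot all_order all_algebra.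
From mathcomp Require Import all_classical all_reals all_analysis.
From mathcomp Require Import measurable_realfun ring lra.
Set Implicit Arguments.
Unset Strict Implicit.
Unset Printing Implicit Defensive.
Import Order.TTheory GRing.Theory Num.Theory.
Import numFieldNormedType.Exports.
Local Open Scope classical_set_scope.
Local Open Scope ring_scope.

(* Both properties are equivalent to the dual inequality
     int e^(a psi) dmu <= e^(a int phi dmu)
   for all bounded measurable psi, phi with psi(x) - phi(y) <= |x - y|^2
   ([inf_conv_ineq] below).

   T_2 implies it by weak Kantorovich duality applied to
   dnu = e^(a psi) dmu / Z, whose entropy is explicit. The dual inequality
   tensorizes by induction on n; for f the distance to A truncated at r and
   t > 0, the pairs (+- t f - t^2/4, +- t f) then give sub-Gaussian deviation
   bounds for f above and below its mean. The lower one bounds the mean by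
   sqrt(ln 2 / a), so the concentration property holds with
   r_o = sqrt(ln 2 / a) and b = 1.

   Conversely, apply concentration to A = {sum_i phi(x_i) <= n (int phi dmu + e)},
   which has measure >= 1/2 for large n: sum_i psi(z_i) exceeds the level of A
   by at most the squared distance of z to A, so for c < a its exponential
   moment is bounded up to a constant independent of n, and taking n-th roots
   gives the dual inequality for c. The Donsker-Varadhan inequality turns it into
   int psi dnu - int phi dmu <= H(nu | mu) / c, and a coupling of cost at most
   H(nu | mu) / c + e is built by solving the transport problem between finitely
   many cells (linear programming duality from Farkas' lemma) and using product
   measures inside cells; second moments, which follow from concentration for
   n = 1 and Donsker-Varadhan, control the unbounded cell. *)

(** * Bounded measurable functions and their expectations *)

Section bounded_measurable.
Context (R : realType).

(** Boundedness makes real-valued integration linear and monotone without integrability side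
    conditions; unbounded functions are reached by truncation. *)
Definition bmf dT (T : measurableType dT) (f : T -> R) : Prop :=
  measurable_fun setT f /\ exists M, forall x, `|f x| <= M.

Section closure.
Context dT (T : measurableType dT).
Implicit Types f g : T -> R.

Lemma bmf_cst (k : R) : bmf (fun _ : T => k).
Proof. by split; [exact: measurable_cst|exists `|k|]. Qed.

Lemma bmfD f g : bmf f -> bmf g -> bmf (fun x => f x + g x).
Proof.
move=> [mf [M fM]] [mg [N gN]]; split; first exact: measurable_funD.
by exists (M + N) => x; rewrite (le_trans (ler_normD _ _))// lerD.
Qed.

Lemma bmfM f g : bmf f -> bmf g -> bmf (fun x => f x * g x).
Proof.
move=> [mf [M fM]] [mg [N gN]]; split; first exact: measurable_funM.
by exists (M * N) => x; rewrite normrM ler_pM.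
Qed.

Lemma bmfZ k f : bmf f -> bmf (fun x => k * f x).
Proof. by move=> ?; apply: bmfM => //; exact: bmf_cst. Qed.

Lemma bmfN f : bmf f -> bmf (fun x => - f x).
Proof.
move=> /(bmfZ (-1)); rewrite (_ : (fun x => -1 * f x) = fun x => - f x)//.
by apply/funext => x; rewrite mulN1r.
Qed.

Lemma bmfB f g : bmf f -> bmf g -> bmf (fun x => f x - g x).
Proof. by move=> bf bg; apply: bmfD => //; exact: bmfN. Qed.

Lemma bmf_expR f : bmf f -> bmf (fun x => expR (f x)).
Proof.
move=> [mf [M fM]]; split; first exact: measurableT_comp.
exists (expR M) => x; rewrite ger0_norm ?expR_ge0// ler_expR.
by rewrite (le_trans _ (fM x))// ler_norm.
Qed.

Lemma bmf_sum (I : Type) (s : seq I) (f : I -> T -> R) :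
  (forall i, bmf (f i)) -> bmf (fun x => \sum_(i <- s) f i x).
Proof.
move=> bf; elim: s => [|i s IH].
  by under eq_fun do rewrite big_nil; exact: bmf_cst.
by under eq_fun do rewrite big_cons; exact: bmfD.
Qed.

Lemma bmf_indic (A : set T) : measurable A -> bmf (\1_A : T -> R).
Proof.
move=> mA; split; first exact: measurable_indic.
by exists 1 => x; rewrite indicE; case: (_ \in _); rewrite ?normr1 ?normr0.
Qed.

Lemma bmf_bounded f M N : measurable_fun setT f ->
  (forall x, M <= f x <= N) -> bmf f.
Proof.
move=> mf fMN; split=> //; exists (`|M| + `|N|) => x.
have /andP[? ?] := fMN x; rewrite ler_norml; apply/andP; split.
  rewrite (le_trans _ (_ : M <= _))// lerNl.
  by rewrite (le_trans (ler_norm _))// normrN lerDl.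
by rewrite (le_trans (_ : _ <= N))// (le_trans (ler_norm _))// lerDr.
Qed.

End closure.

Lemma bmf_comp d1 d2 (T1 : measurableType d1) (T2 : measurableType d2)
  (h : T1 -> T2) (f : T2 -> R) :
  measurable_fun setT h -> bmf f -> bmf (fun x => f (h x)).
Proof.
move=> mh [mf [M fM]]; split; first exact: measurableT_comp.
by exists M => x.
Qed.

Section expectation.
Context dT (T : measurableType dT) (P : probability T R).
Implicit Types f g : T -> R.

Lemma bmf_integrable f : bmf f -> P.-integrable setT (EFin \o f).
Proof.
move=> [mf [M fM]]; apply: measurable_bounded_integrable => //.
  by rewrite (le_lt_trans (probability_le1 P measurableT))// ltry.
by exists M; split; [exact: num_real|move=> x /ltW Mx y _; exact: le_trans (fM y) Mx].
Qed.

Lemma EFin_bE f : bmf f -> ((\int[P]_x f x)%:E = \int[P]_x (f x)%:E)%E.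
Proof. by move=> /bmf_integrable bf; rewrite fineK// integrable_fin_num. Qed.

Lemma bE_cst k : \int[P]_x k = k.
Proof. by rewrite Rintegral_cst// [X in fine X](@probability_setT _ _ _ P) mulr1. Qed.

Lemma le_bE f g : bmf f -> bmf g -> (forall x, f x <= g x) ->
  \int[P]_x f x <= \int[P]_x g x.
Proof. by move=> bf bg fg; apply: le_Rintegral => //; exact: bmf_integrable. Qed.

Lemma bED f g : bmf f -> bmf g ->
  \int[P]_x (f x + g x) = \int[P]_x f x + \int[P]_x g x.
Proof. by move=> bf bg; rewrite RintegralD//; exact: bmf_integrable. Qed.

Lemma bEZ k f : bmf f -> \int[P]_x (k * f x) = k * \int[P]_x f x.
Proof. by move=> bf; rewrite RintegralZl//; exact: bmf_integrable. Qed.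

Lemma bEB f g : bmf f -> bmf g ->
  \int[P]_x (f x - g x) = \int[P]_x f x - \int[P]_x g x.
Proof. by move=> bf bg; rewrite RintegralB//; exact: bmf_integrable. Qed.

Lemma bE_sum (I : Type) (s : seq I) (f : I -> T -> R) :
  (forall i, bmf (f i)) ->
  \int[P]_x (\sum_(i <- s) f i x) = \sum_(i <- s) \int[P]_x (f i x).
Proof.
move=> bf; elim: s => [|i s IH].
  by under eq_Rintegral do rewrite big_nil; rewrite bE_cst big_nil.
under eq_Rintegral do rewrite big_cons.
by rewrite bED ?IH ?big_cons//; exact: bmf_sum.
Qed.

Lemma bE_indic (A : set T) : measurable A -> (\int[P]_x (\1_A x))%:E = P A.
Proof.
move=> mA; rewrite EFin_bE; last exact: bmf_indic.
by rewrite integral_indic// setIT.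
Qed.

Lemma bE_ge f k : bmf f -> (forall x, k <= f x) -> k <= \int[P]_x f x.
Proof.
by move=> bf kf; rewrite -[leLHS]bE_cst; apply: le_bE => //; exact: bmf_cst.
Qed.

Lemma bE_le f k : bmf f -> (forall x, f x <= k) -> \int[P]_x f x <= k.
Proof.
by move=> bf kf; rewrite -[leRHS]bE_cst; apply: le_bE => //; exact: bmf_cst.
Qed.

Lemma bE_expR_gt0 f : bmf f -> 0 < \int[P]_x expR (f x).
Proof.
move=> bf; have [_ [M fM]] := bf; apply: (@lt_le_trans _ _ (expR (- M))).
  exact: expR_gt0.
apply: bE_ge; first exact: bmf_expR.
by move=> x; rewrite ler_expR; have := fM x; rewrite ler_norml => /andP[].
Qed.

End expectation.

Lemma bE_pushforward dT (T : measurableType dT) (P : probability T R)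
  d' (T' : measurableType d') (h : T -> T') (Q : probability T' R)
  (g : T' -> R) : measurable_fun setT h ->
  (forall A, measurable A -> Q A = P (h @^-1` A)) -> bmf g ->
  \int[Q]_y g y = \int[P]_x g (h x).
Proof.
move=> mh QE bg; apply: EFin_inj; rewrite EFin_bE// EFin_bE; last exact: bmf_comp.
rewrite -[RHS](@integral_pushforward _ _ _ _ _ h mh P setT (EFin \o g))//.
- by apply: eq_measure_integral => A mA _; exact: QE.
- by apply/measurable_EFinP; case: bg.
- exact/bmf_integrable/bmf_comp.
Qed.

Lemma bmf_bE_fubini d1 d2 (T1 : measurableType d1) (T2 : measurableType d2)
  (P2 : probability T2 R) (f : T1 * T2 -> R) :
  bmf f -> bmf (fun x => \int[P2]_y f (x, y)).
Proof.
move=> bf; have [mf [M fM]] := bf.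
have bx x : bmf (fun y => f (x, y)) by exact: bmf_comp.
apply: (@bmf_bounded _ _ _ (- M) M) => [|x]; last first.
  have Hx y : - M <= f (x, y) <= M by rewrite -ler_norml.
  by apply/andP; split; [apply: bE_ge|apply: bE_le] => // y;
    have /andP[] := Hx y.
(* Tonelli measurability concerns nonnegative functions, hence the shift by the bound [M]. *)
have bfM : bmf (fun z => f z + M) by apply: bmfD => //; exact: bmf_cst.
rewrite (_ : (fun x => _) = (fun x => \int[P2]_y (f (x, y) + M) - M)); last first.
  apply/funext => x; rewrite bED//; last exact: bmf_cst.
  by rewrite bE_cst addrK.
apply: measurable_funB => //.
apply: measurableT_comp => //.
apply: (@measurable_fun_fubini_tonelli_F _ _ _ _ R P2 (fun z => (f z + M)%:E)).
  by apply/measurable_EFinP; case: bfM.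
by move=> z; rewrite lee_fin; have := fM z; rewrite ler_norml => /andP[]; lra.
Qed.

Lemma bE_fubini d1 d2 (T1 : measurableType d1) (T2 : measurableType d2)
  (P1 : probability T1 R) (P2 : probability T2 R) (f : T1 * T2 -> R) :
  bmf f -> \int[(P1 \x P2)%E]_z f z = \int[P1]_x \int[P2]_y f (x, y).
Proof.
move=> bf; apply: EFin_inj.
rewrite (@EFin_bE _ _ (P1 \x P2)%E)// EFin_bE; last exact: bmf_bE_fubini.
rewrite -integral12_prod_meas1; last exact: (@bmf_integrable _ _ (P1 \x P2)%E).
apply: eq_integral => x _; rewrite EFin_bE//.
by apply: (@bmf_comp _ _ _ _ (pair x)).
Qed.

End bounded_measurable.

(** Positive and negative parts are compared separately, so the bound also covers infinite
    integrals, which entropies and transport costs may be. *)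
Lemma le_integral_measurable dT (T : measurableType dT) (R : realType)
  (mu : {measure set T -> \bar R}) (f g : T -> \bar R) :
  measurable_fun setT f -> measurable_fun setT g -> (forall x, f x <= g x)%E ->
  (\int[mu]_x f x <= \int[mu]_x g x)%E.
Proof.
move=> mf mg fg; rewrite integralE [leRHS]integralE; apply: leeB.
- apply: ge0_le_integral => //; [exact: measurable_funepos..|].
  by move=> x _; apply: (@funepos_le _ _ setT) (in_setT x) => y _.
- apply: ge0_le_integral => //; [exact: measurable_funeneg..|].
  by move=> x _; apply: (@funeneg_le _ _ setT) (in_setT x) => y _.
Qed.

(** * Probability measures given by a bounded density *)

Section density_probability.
Context dT (T : measurableType dT) (R : realType) (P : probability T R).
Context (w : T -> R) (bw : bmf w) (w0 : forall x, 0 <= w x).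
Context (w1 : \int[P]_x w x = 1).

(* The proof arguments make the measure and probability structures inferable. *)
Definition density_measure of bmf w & (forall x, 0 <= w x) & \int[P]_x w x = 1 :=
  fun A : set T => (\int[P]_(x in A) (w x)%:E)%E.

Local Notation nu := (density_measure bw w0 w1).

Let nu0 : nu set0 = 0%E.
Proof. exact: integral_set0. Qed.

Let nu_ge0 A : (0 <= nu A)%E.
Proof. by apply: integral_ge0 => x _; rewrite lee_fin. Qed.

Let nu_sigma_additive : semi_sigma_additive nu.
Proof.
apply: semi_sigma_additive_nng_induced => [|x]; last by rewrite lee_fin.
by apply/measurable_EFinP; case: bw.
Qed.

HB.instance Definition _ := isMeasure.Build _ _ _ nu
  nu0 nu_ge0 nu_sigma_additive.

Let nu_setT : nu setT = 1%E.
Proof. by rewrite -[1%E]/(1%:E) -w1 EFin_bE. Qed.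

HB.instance Definition _ := Measure_isProbability.Build _ _ _ nu nu_setT.

Lemma density_probability : exists Q : probability T R,
  forall A, measurable A -> Q A = (\int[P]_(x in A) (w x)%:E)%E.
Proof. by exists nu. Qed.

End density_probability.

(** * Relative entropy: the Donsker-Varadhan inequality and its equality case *)

Section entropy.
Context (R : realType) (d : nat).
Local Notation T := (d.-tuple R).
Implicit Types mu nu : probability T R.

(** One half of the variational formula for entropy; it turns exponential moments under [mu] into
    expectation bounds under [nu]. *)
Lemma donsker_varadhan mu nu (g : T -> R) : bmf g ->
  ((\int[nu]_x g x - ln (\int[mu]_x expR (g x)))%:E <= relative_entropy nu mu)%E.
Proof.
move=> bg; rewrite /relative_entropy; case: pselect => [numu|nnumu] /=; last exact: leey.
set f := Radon_Nikodym_SigmaFinite.f nu mu; set Z := \int[mu]_x _.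
have Z0 : 0 < Z by exact: bE_expR_gt0.
have f0 x : (0 <= f x)%E by exact: Radon_Nikodym_SigmaFinite.f_ge0.
have ffin x : f x \is a fin_num by exact: Radon_Nikodym_SigmaFinite.f_fin_num.
have mf : measurable_fun setT f.
  exact: measurable_int (Radon_Nikodym_SigmaFinite.f_integrable numu).
have mlnf : measurable_fun setT (fun x => ln (fine (f x))).
  by apply: measurableT_comp => //; exact: measurableT_comp.
have [mg _] := bg.
(* k is the density of e^g mu / Z with respect to nu; apply e^t >= 1 + t to
   its logarithm. *)
pose k x := expR (g x - ln Z - ln (fine (f x))).
have mk : measurable_fun setT k.
  by apply: measurableT_comp => //; apply: measurable_funB => //; exact: measurable_funB.
(* Equality may fail: the part of [expR g] times [mu] living where [f] vanishes is invisible to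
   [nu]. *)
have k1 : (\int[nu]_x (k x)%:E <= 1)%E.
  rewrite -(Radon_Nikodym_SigmaFinite.change_of_variables numu)//; first last.
  - exact/measurable_EFinP.
  - by move=> x; rewrite lee_fin expR_ge0.
  have -> : 1%E = (\int[mu]_x (Z^-1 * expR (g x))%:E)%E :> \bar R.
    by rewrite -EFin_bE ?bEZ ?mulVf ?gt_eqF//; [exact: bmf_expR|exact/bmfZ/bmf_expR].
  apply: ge0_le_integral => //.
  - by move=> x _; rewrite mule_ge0// lee_fin expR_ge0.
  - by apply: emeasurable_funM => //; exact/measurable_EFinP.
  - by apply/measurable_EFinP; case: (bmfZ Z^-1 (bmf_expR bg)).
  - move=> x _; rewrite -[X in (_ * X)%E]fineK// -EFinM lee_fin /k.
    (* Where the density vanishes, [expR (ln _)] cannot be simplified, but the factor [f x] makes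
       the left side nonpositive. *)
    have [fx0|fx0] := leP (fine (f x)) 0.
      rewrite (le_trans (_ : _ <= 0))//; first by rewrite mulr_ge0_le0 ?expR_ge0.
      by rewrite mulr_ge0 ?expR_ge0// invr_ge0 ltW.
    rewrite !expRD !expRN !lnK ?posrE// mulrVK ?unitfE ?gt_eqF//.
    by rewrite mulrC.
have intk : nu.-integrable setT (EFin \o k).
  apply/integrableP; split; first exact/measurable_EFinP.
  under eq_integral do rewrite /= [X in X%:E]ger0_norm ?expR_ge0//.
  by rewrite (le_lt_trans k1) ?ltry.
(* [l] minorizes [ln f], and its part [1 - k] has nonnegative [nu]-integral by [k1]. *)
pose l x := (g x - ln Z + 1) - k x.
have bl : bmf (fun x => g x - ln Z + 1).
  by apply: bmfD; [apply: bmfB|]; rewrite //; exact: bmf_cst.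
apply: (@le_trans _ _ (\int[nu]_x (l x)%:E)%E); last first.
  apply: le_integral_measurable; [|exact/measurable_EFinP|].
    by apply/measurable_EFinP; apply: measurable_funB => //; case: bl.
  move=> x; rewrite lee_fin /l lerBlDr -lerBlDl.
  rewrite (_ : _ - ln (fine (f x)) = 1 + (g x - ln Z - ln (fine (f x)))); last by ring.
  exact: expR_ge1Dx.
rewrite /l; under eq_integral do rewrite EFinB.
rewrite integralB//; last exact: bmf_integrable.
rewrite -EFin_bE// bED; [|by apply: bmfB => //; exact: bmf_cst|exact: bmf_cst].
rewrite bEB ?bE_cst//; last exact: bmf_cst.
rewrite [in leRHS]EFinD -addeA leeDl//.
by rewrite sube_ge0 ?orbT//; exact: k1.
Qed.

(** The Gibbs measure with density [expR g / Z] has log-density [g - ln Z]; it is the equality case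
    of Donsker-Varadhan. *)
Lemma gibbs_entropy mu (g : T -> R) : bmf g ->
  exists nu : probability T R,
  relative_entropy nu mu = (\int[nu]_x g x - ln (\int[mu]_x expR (g x)))%:E.
Proof.
move=> bg; set Z := \int[mu]_x _; have Z0 : 0 < Z by exact: bE_expR_gt0.
pose w x := Z^-1 * expR (g x).
have bw : bmf w by exact/bmfZ/bmf_expR.
have w0 x : 0 < w x by rewrite mulr_gt0 ?expR_gt0// invr_gt0.
have w1 : \int[mu]_x w x = 1 by rewrite bEZ ?mulVf ?gt_eqF//; exact: bmf_expR.
have [nu nuE] := density_probability bw (fun x => ltW (w0 x)) w1.
exists nu; have [mw _] := bw.
have numu : nu `<< mu.
  apply/null_content_dominatesP => A mA muA0; rewrite nuE// null_set_integral//.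
  exact/measurable_funTS/measurable_EFinP.
rewrite /relative_entropy; case: pselect => // numu'.
set f := Radon_Nikodym_SigmaFinite.f nu mu.
have intf : mu.-integrable setT f by exact: Radon_Nikodym_SigmaFinite.f_integrable.
(* The Radon-Nikodym derivative is known only through its integrals, so it is identified with [w]
   almost everywhere for [mu], then for [nu] by domination. *)
have fw : ae_eq mu setT f (EFin \o w).
  apply: integral_ae_eq => //; first exact/measurable_EFinP.
  by move=> E _ mE; rewrite -Radon_Nikodym_SigmaFinite.f_integral//; exact: nuE.
have fw' : ae_eq nu setT (fun x => (ln (fine (f x)))%:E) (fun x => (g x - ln Z)%:E).
  have : ae_eq nu setT f (EFin \o w).
    exact: null_dominates_ae_eq numu fw.
  apply: filterS => x /(_ I) /= ->//= _.
  by rewrite /w lnM ?posrE ?invr_gt0 ?expR_gt0// lnV ?posrE// expRK addrC.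
rewrite (ae_eq_integral _ _ _ _ _ fw')//.
- by rewrite -EFin_bE ?bEB ?bE_cst//; [exact: bmf_cst|apply: bmfB => //; exact: bmf_cst].
- apply/measurable_EFinP; apply: measurableT_comp => //; apply: measurableT_comp => //.
  exact: measurable_int intf.
- by apply/measurable_EFinP; apply: measurable_funB => //; case: bg.
Qed.

End entropy.

Lemma measurable_rectangle dV (V : measurableType dV) n (A : 'I_n -> set V) :
  (forall i, measurable (A i)) ->
  measurable [set x : n.-tuple V | forall i, A i (tnth x i)].
Proof.
move=> mA; rewrite [X in measurable X](_ : _ =
  \bigcap_(i in [set: 'I_n]) ((@tnth n V)^~ i @^-1` A i)); last first.
  by apply/seteqP; split=> x /= Ax i => [_|]; exact: Ax.
apply: fin_bigcap_measurable => // i _; rewrite -[X in measurable X]setTI.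
exact: measurable_tnth.
Qed.

(** * Product measures on tuples *)

Section product_measure.
Context (R : realType) (d : nat).
Local Notation T := (d.-tuple R).
Implicit Types mu : probability T R.

Definition tuple_cons n (z : T * n.-tuple T) : n.+1.-tuple T :=
  [tuple of z.1 :: z.2].

Lemma measurable_tuple_cons n : measurable_fun setT (@tuple_cons n).
Proof. exact: measurable_cons. Qed.

Lemma product_measure_cons mu n (Q : probability (n.-tuple T) R) :
  is_product_measure mu Q ->
  exists2 P : probability (n.+1.-tuple T) R, is_product_measure mu P &
    forall A, P A = (mu \x Q)%E (@tuple_cons n @^-1` A).
Proof.
move=> QE; pose h : {mfun (T * n.-tuple T)%type >-> n.+1.-tuple T} :=
  HB.pack (@tuple_cons n) (isMeasurableFun.Build _ _ _ _ _ (@measurable_tuple_cons n)).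
exists (distribution (mu \x Q)%E h : probability _ R) => // A mA.
rewrite big_ord_recl -QE//.
rewrite -product_measure1E//; last first.
  exact: (@measurable_rectangle _ _ _ (fun i => A (lift ord0 i))).
congr (product_measure1 _ _ _); apply/seteqP; split => -[x y]/=.
  move=> Axy; split=> [|i]; first exact: (Axy ord0).
  by have := Axy (lift ord0 i); rewrite tnthS.
move=> [Ax Ay] i; case: (unliftP ord0 i) => [j|] ->; last exact: Ax.
by rewrite tnthS; exact: Ay.
Qed.

Lemma product_measure_exists mu n :
  exists P : probability (n.-tuple T) R, is_product_measure mu P.
Proof.
elim: n => [|n [Q /product_measure_cons[P PE _]]]; last by exists P.
exists (dirac [tuple] : probability _ R) => A mA; rewrite big_ord0.
have -> : [set x : 0.-tuple T | forall i, A i (tnth x i)] = setT.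
  by apply/seteqP; split => // x _ [].
exact: probability_setT.
Qed.

(** Rectangles are stable under intersection, include the whole space and generate the sigma-algebra
    of tuples. *)
Lemma product_measure_eq mu n (P Q : probability (n.-tuple T) R) :
  is_product_measure mu P -> is_product_measure mu Q ->
  forall A, measurable A -> P A = Q A.
Proof.
move=> PE QE A mA.
pose G := [set B | exists2 C : 'I_n -> set T, (forall i, measurable (C i)) &
                     B = [set x : n.-tuple T | forall i, C i (tnth x i)]].
have GT : G setT.
  by exists (fun _ => setT) => //; apply/seteqP; split => x.
apply: (@g_sigma_algebra_measure_unique _ _ _ G _ (fun _ => setT)) => //.
- by move=> _ [C mC ->]; exact: measurable_rectangle.
- by rewrite bigcup_const.
- move=> _ _ [B mB ->] [C mC ->]; exists (fun i => B i `&` C i).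
    by move=> i; exact: measurableI.
  apply/seteqP; split => x /=; first by move=> [? ?] i.
  by move=> BC; split => i; have [] := BC i.
- by move=> _ [C mC ->]; exact: etrans (PE _ mC) (esym (QE _ mC)).
- by move=> _; exact: le_lt_trans (probability_le1 _ measurableT) (ltry _).
- move: A mA; apply: smallest_sub; first exact: smallest_sigma_algebra.
  move=> B; rewrite -bigcup_seq/= => -[i _ [C mC <-]].
  apply: sub_sigma_algebra; rewrite setTI.
  exists (fun j => if j == i then C else setT); first by move=> j; case: ifP.
  apply/seteqP; split => x /= => [Cx j|/(_ i)]; last by rewrite eqxx.
  by case: eqP => // ->.
Qed.

(** By uniqueness, any product measure is the image of [mu \x Q] under consing; this drives the
    inductions on [n]. *)
Lemma product_measureS mu n (P : probability (n.+1.-tuple T) R) :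
  is_product_measure mu P ->
  exists2 Q : probability (n.-tuple T) R, is_product_measure mu Q &
    forall f, bmf f ->
      \int[P]_x f x = \int[mu]_x \int[Q]_y f (tuple_cons (x, y)).
Proof.
move=> PE; have [Q QE] := product_measure_exists mu n; exists Q => // f bf.
have bf' : bmf (fun z => f (@tuple_cons n z)).
  by apply: bmf_comp => //; exact: measurable_tuple_cons.
rewrite -(bE_fubini mu Q bf').
apply: (@bE_pushforward _ _ _ (mu \x Q)%E) => //; first exact: measurable_tuple_cons.
have [P' P'E P'A] := product_measure_cons QE.
by move=> A mA; exact: etrans (product_measure_eq PE P'E mA) (P'A A).
Qed.

Lemma bmf_tnth n (i : 'I_n) (f : T -> R) :
  bmf f -> bmf (fun x : n.-tuple T => f (tnth x i)).
Proof. by move=> bf; apply: (bmf_comp _ bf); exact: measurable_tnth. Qed.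

Lemma bE_product_expR mu n (P : probability (n.-tuple T) R) (f : T -> R) :
  is_product_measure mu P -> bmf f ->
  \int[P]_x expR (\sum_(i < n) f (tnth x i)) = (\int[mu]_x expR (f x)) ^+ n.
Proof.
elim: n => [|n IH] in P *.
  by move=> _ _; under eq_Rintegral do rewrite big_ord0; rewrite bE_cst expR0.
move=> PE bf; have [Q QE ->] := product_measureS PE; last first.
  by apply/bmf_expR/bmf_sum => i; exact: bmf_tnth.
have be : bmf (fun x => expR (f x)) by exact: bmf_expR.
transitivity (\int[mu]_x ((\int[mu]_x expR (f x)) ^+ n * expR (f x))); last first.
  by rewrite bEZ// exprSr.
apply: eq_Rintegral => x _; rewrite -(IH _ QE bf) mulrC -bEZ; last first.
  by apply/bmf_expR/bmf_sum => i; exact: bmf_tnth.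
apply: eq_Rintegral => y _; rewrite big_ord_recl/= expRD; congr (_ * expR _).
by apply: eq_bigr => i _; rewrite tnthS.
Qed.

End product_measure.

(** For a given [phi] the largest admissible [psi] is the infimum convolution
    [x |-> inf_y (phi y + cost x y)]; quantifying over pairs avoids its measurability. *)
Definition inf_conv_ineq dT (T : measurableType dT) (R : realType)
  (cost : T -> T -> R) (c : R) (P : probability T R) :=
  forall psi phi : T -> R, bmf psi -> bmf phi ->
    (forall x y, psi x - phi y <= cost x y) ->
    \int[P]_x expR (c * psi x) <= expR (c * \int[P]_x phi x).

(** * The quadratic cost on points and on tuples of points *)

Section sqdist_measurable.
Context (R : realType) (d : nat).
Local Notation T := (d.-tuple R).

Lemma measurable_sqdist dU (U : measurableType dU) (f g : U -> T) :
  measurable_fun setT f -> measurable_fun setT g ->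
  measurable_fun setT (fun z => sqdist (f z) (g z)).
Proof.
move=> mf mg; apply: measurable_sum => j; apply: measurable_funX.
apply: measurable_funB.
  exact: (measurable_fun_tnthP f).1.
exact: (measurable_fun_tnthP g).1.
Qed.

Lemma measurable_sqdistn n dU (U : measurableType dU) (f g : U -> n.-tuple T) :
  measurable_fun setT f -> measurable_fun setT g ->
  measurable_fun setT (fun z => sqdistn (f z) (g z)).
Proof.
move=> mf mg; apply: measurable_sum => j; apply: measurable_sqdist.
  exact: (measurable_fun_tnthP f).1.
exact: (measurable_fun_tnthP g).1.
Qed.

Lemma sqdist_ge0 (x y : T) : 0 <= sqdist x y.
Proof. by apply: sumr_ge0 => j _; exact: sqr_ge0. Qed.

Lemma sqdistn_ge0 n (x y : n.-tuple T) : 0 <= sqdistn x y.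
Proof. by apply: sumr_ge0 => j _; exact: sqdist_ge0. Qed.

End sqdist_measurable.

(** * From the transport inequality to the dual inequality, and its tensorization *)

Section transport_entropy_dual.
Context (R : realType) (d : nat).
Local Notation T := (d.-tuple R).
Implicit Types mu nu : probability T R.

Lemma bE_coupling nu mu (pi : probability (T * T)%type R) (f g : T -> R) :
  is_coupling nu mu pi -> bmf f -> bmf g ->
  \int[pi]_z f z.1 = \int[nu]_x f x /\ \int[pi]_z g z.2 = \int[mu]_x g x.
Proof.
move=> cpi bf bg; split; apply/esym; apply: bE_pushforward => // A mA.
  have [<- _] := cpi A mA; congr (pi _).
  by apply/seteqP; split => [[x y] []|[x y]].
have [_ <-] := cpi A mA; congr (pi _).
by apply/seteqP; split => [[x y] []|[x y]].
Qed.

Lemma kantorovich_le nu mu (psi phi : T -> R) : bmf psi -> bmf phi ->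
  (forall x y, psi x - phi y <= sqdist x y) ->
  ((\int[nu]_x psi x - \int[mu]_x phi x)%:E <= transport_cost2 nu mu)%E.
Proof.
move=> bpsi bphi psiphi; apply: le_ereal_inf_tmp => _ [pi cpi <-].
have [<- <-] := bE_coupling cpi bpsi bphi.
have bpsi1 : bmf (fun z : T * T => psi z.1) by exact: bmf_comp.
have bphi2 : bmf (fun z : T * T => phi z.2) by exact: bmf_comp.
rewrite -bEB// EFin_bE; last exact: bmfB.
apply: le_integral_measurable.
- by apply/measurable_EFinP; case: (bmfB bpsi1 bphi2).
- by apply/measurable_EFinP; exact: measurable_sqdist.
- by move=> z; rewrite lee_fin.
Qed.

(** For the Gibbs measure of [a * psi], the integral of [psi] under [nu] appears both in weak
    duality and in the entropy and cancels; what remains is the logarithm of the claim. *)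
Lemma transport_entropy_inf_conv mu (a : R) : 0 < a ->
  (forall nu, transport_cost2 nu mu <= a^-1%:E * relative_entropy nu mu)%E ->
  inf_conv_ineq (@sqdist R d) a mu.
Proof.
move=> a0 T2 psi phi bpsi bphi psiphi.
have [nu Hnu] := gibbs_entropy mu (bmfZ a bpsi).
have := le_trans (kantorovich_le nu mu bpsi bphi psiphi) (T2 nu).
rewrite Hnu -EFinM lee_fin bEZ// mulrBr mulKf ?gt_eqF// lerD2l lerN2.
rewrite ler_pdivrMl// => H.
rewrite -[leLHS]lnK ?ler_expR// posrE.
exact/bE_expR_gt0/bmfZ.
Qed.

Lemma bmf_ln_bE d1 d2 (T1 : measurableType d1) (T2 : measurableType d2)
  (Q : probability T2 R) (f : T1 * T2 -> R) : bmf f ->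
  bmf (fun x => ln (\int[Q]_y expR (f (x, y)))).
Proof.
move=> bf; have [mf [M fM]] := bf; have bef := bmf_expR bf.
have [mE _] := bmf_bE_fubini Q bef.
apply: (@bmf_bounded _ _ _ _ (- M) M) => [|x]; first exact: measurableT_comp.
have bx : bmf (fun y => f (x, y)) by exact: bmf_comp.
have E0 := bE_expR_gt0 Q bx.
rewrite -ler_expR -[X in _ && X]ler_expR lnK ?posrE//.
by apply/andP; split; [apply: bE_ge|apply: bE_le]; rewrite //; try exact: bmf_expR;
  move=> y; rewrite ler_expR; have := fM (x, y); rewrite ler_norml => /andP[].
Qed.

(** The squared distance is the sum of the cost of the first coordinate and that of the others, so
    the two inequalities can be applied one after the other. *)
Lemma inf_conv_ineq_tensor mu (a : R) n (P : probability (n.-tuple T) R) :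
  0 < a -> inf_conv_ineq (@sqdist R d) a mu -> is_product_measure mu P ->
  inf_conv_ineq (@sqdistn R d n) a P.
Proof.
move=> a0 Hmu; elim: n => [|n IH] in P * => PE psi phi bpsi bphi psiphi.
  (* On the one-point space the cost is 0, so [psi <= phi]. *)
  apply: (@le_trans _ _ (expR (a * psi [tuple]))).
    by apply: bE_le => [|x]; [exact/bmf_expR/bmfZ|rewrite (tuple0 x)].
  rewrite ler_expR ler_pM2l//; apply: bE_ge => // x; rewrite -subr_le0.
  by rewrite (le_trans (psiphi _ _))// /sqdistn big_ord0.
have [Q QE PQ] := product_measureS PE.
rewrite !PQ//; last exact/bmf_expR/bmfZ.
have bcons (f : n.+1.-tuple T -> R) : bmf f -> bmf (fun z => f (@tuple_cons R d n z)).
  by apply: bmf_comp; exact: measurable_tuple_cons.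
have bpsic : bmf (fun z => a * psi (@tuple_cons R d n z)) by exact/bmfZ/bcons.
have bphic := bcons _ bphi.
(* One-dimensional pair obtained by applying the inductive hypothesis to
   y |-> psi (x, y) - |x - x'|^2 and phi (x', _). *)
pose Psi x := a^-1 * ln (\int[Q]_y expR (a * psi (tuple_cons (x, y)))).
pose Phi x := \int[Q]_y phi (tuple_cons (x, y)).
have bPsi : bmf Psi by apply: bmfZ; exact: (bmf_ln_bE Q bpsic).
have bPhi : bmf Phi by exact: (bmf_bE_fubini Q bphic).
have bpsix x : bmf (fun y => psi (@tuple_cons R d n (x, y))).
  exact: (@bmf_comp _ _ _ _ _ (pair x) _ _ (bcons _ _)).
have bphix x : bmf (fun y => phi (@tuple_cons R d n (x, y))).
  exact: (@bmf_comp _ _ _ _ _ (pair x) _ _ (bcons _ _)).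
have E0 x : 0 < \int[Q]_y expR (a * psi (tuple_cons (x, y))).
  exact/bE_expR_gt0/bmfZ.
have PsiPhi x x' : Psi x - Phi x' <= sqdist x x'.
  rewrite lerBlDr ler_pdivrMl// -ler_expR lnK ?posrE//.
  have bs : bmf (fun y => psi (@tuple_cons R d n (x, y)) - sqdist x x').
    by apply: bmfB => //; exact: bmf_cst.
  have := IH Q QE _ _ bs (bphix x').
  have -> : \int[Q]_y expR (a * (psi (tuple_cons (x, y)) - sqdist x x')) =
      expR (- (a * sqdist x x')) * \int[Q]_y expR (a * psi (tuple_cons (x, y))).
    rewrite -bEZ; last exact/bmf_expR/bmfZ.
    by apply: eq_Rintegral => y _; rewrite -expRD mulrBr addrC.
  rewrite expRN mulrDr expRD ler_pdivrMl ?expR_gt0//; apply => y y'.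
  have := psiphi (tuple_cons (x, y)) (tuple_cons (x', y')).
  have -> : sqdistn (tuple_cons (x, y)) (tuple_cons (x', y')) =
      sqdist x x' + sqdistn y y'.
    rewrite /sqdistn big_ord_recl; congr (_ + _).
    by apply: eq_bigr => i _; rewrite !tnthS.
  lra.
have := Hmu _ _ bPsi bPhi PsiPhi; apply: le_trans.
by apply: le_bE => [||x];
  [exact: (bmf_bE_fubini Q (bmf_expR bpsic))|exact/bmf_expR/bmfZ|];
  rewrite /Psi mulVKf ?gt_eqF// lnK ?posrE.
Qed.

End transport_entropy_dual.

(** * Gaussian concentration from the dual inequality *)

Section concentration.
Context (R : realType) (d n : nat).
Local Notation T := (d.-tuple R).
Local Notation V := (n.-tuple T).
Implicit Types x y z : V.

Definition edist (x y : V) : R := Num.sqrt (sqdistn x y).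

Lemma edist_ge0 x y : 0 <= edist x y.
Proof. exact: sqrtr_ge0. Qed.

Lemma edistC x y : edist x y = edist y x.
Proof.
congr Num.sqrt; apply: eq_bigr => i _; apply: eq_bigr => j _.
by rewrite -sqrrN opprB.
Qed.

Lemma edistxx x : edist x x = 0.
Proof.
rewrite /edist /sqdistn big1 ?sqrtr0// => i _; rewrite /sqdist big1// => j _.
by rewrite subrr expr0n.
Qed.

Lemma sqr_edist x y : edist x y ^+ 2 = sqdistn x y.
Proof. by rewrite sqr_sqrtr// sqdistn_ge0. Qed.

(** Coordinatewise the difference is the square [t * ((p - q) - (q - r) / t) ^+ 2]. Choosing [t]
    well gives the triangle inequality without Cauchy-Schwarz. *)
Lemma sqdistn_young (t : R) x y z : 0 < t ->
  sqdistn x z <= (1 + t) * sqdistn x y + (1 + t^-1) * sqdistn y z.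
Proof.
move=> t0; rewrite /sqdistn 2!mulr_sumr -big_split; apply: ler_sum => i _ /=.
rewrite /sqdist 2!mulr_sumr -big_split; apply: ler_sum => j _ /=.
set p := tnth (tnth x i) j; set q := tnth (tnth y i) j; set r := tnth (tnth z i) j.
rewrite -subr_ge0 (_ : _ - _ = t * ((p - q) - t^-1 * (q - r)) ^+ 2).
  by rewrite mulr_ge0 ?sqr_ge0// ltW.
by field; rewrite gt_eqF.
Qed.

Lemma edist_triangle y x z : edist x z <= edist x y + edist y z.
Proof.
apply/ler_addgt0Pr => e e0.
set u := edist x y; set v := edist y z.
have u0 : 0 <= u := edist_ge0 x y; have v0 : 0 <= v := edist_ge0 y z.
have ue : 0 < u + e by lra. have ve : 0 < v + e by lra.
rewrite -(@ler_pXn2r _ 2) ?nnegrE ?edist_ge0//; last by lra.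
(* t = v / u is optimal; adding e avoids dividing by zero *)
rewrite sqr_edist; have := @sqdistn_young ((v + e) / (u + e)) x y z (divr_gt0 ve ue).
rewrite -!sqr_edist -/u -/v invf_div => /le_trans; apply.
have hu : u ^+ 2 / (u + e) <= u by rewrite ler_pdivrMr// expr2 ler_wpM2l//; lra.
have hv : v ^+ 2 / (v + e) <= v by rewrite ler_pdivrMr// expr2 ler_wpM2l//; lra.
have -> : (1 + (v + e) / (u + e)) * u ^+ 2 =
    u ^+ 2 + (v + e) * (u ^+ 2 / (u + e)) by ring.
have -> : (1 + (u + e) / (v + e)) * v ^+ 2 =
    v ^+ 2 + (u + e) * (v ^+ 2 / (v + e)) by ring.
have := ler_wpM2l (ltW ve) hu; have := ler_wpM2l (ltW ue) hv.
by nra.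
Qed.

Definition rat_point (q : n.-tuple (d.-tuple rat)) : V :=
  [tuple [tuple ratr (tnth (tnth q i) j) | j < d] | i < n].

Lemma rat_point_dense x (e : R) : 0 < e -> exists q, edist x (rat_point q) < e.
Proof.
(* The successor keeps the denominator positive and makes [n * d * k ^+ 2 < e ^+ 2]. *)
move=> e0; pose k := e / (n * d).+1%:R.
have k0 : 0 < k by rewrite divr_gt0.
have /choice[r rP] : forall ij : 'I_n * 'I_d, exists q : rat,
    (tnth (tnth x ij.1) ij.2 - ratr q) ^+ 2 <= k ^+ 2.
  move=> ij; set t := tnth _ _.
  have [|q /[!in_itv]/= /andP[q1 q2]] := @rat_in_itvoo R (t - k) (t + k); first by lra.
  exists q; rewrite -(@real_normK _ (t - _)) ?num_real// ler_pXn2r ?nnegrE//; last exact: ltW.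
  by rewrite ler_norml; apply/andP; split; lra.
exists [tuple [tuple r (i, j) | j < d] | i < n].
rewrite -(@ltr_pXn2r _ 2) ?nnegrE ?edist_ge0//; last exact: ltW.
rewrite sqr_edist; apply: (@le_lt_trans _ _ (\sum_(i < n) \sum_(j < d) k ^+ 2)).
  apply: ler_sum => i _; apply: ler_sum => j _.
  by have := rP (i, j); rewrite !tnth_mktuple.
rewrite !sumr_const !card_ord -mulrnA mulnC -[_ *+ _]mulr_natr /k expr_div_n.
rewrite mulrAC ltr_pdivrMr ?exprn_gt0// ltr_pM2l ?exprn_gt0//.
by rewrite -natrX ltr_nat (leq_trans (ltnSn _))// expnS leq_pmulr// expn_gt0.
Qed.

(** Such an [f] is the infimum of countably many cones [f q + edist x q] with rational apex [q].
    This covers distances to arbitrary sets, which are uncountable infima. *)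
Lemma measurable_lipschitz (f : V -> R) :
  (forall x y, f x <= f y + edist x y) -> measurable_fun setT f.
Proof.
move=> fL mT; apply: (measurability _ (RGenInftyO.measurableE R)) => //.
move=> _ [_ [c ->] <-]; rewrite setTI.
have -> : f @^-1` `]-oo, c[%classic =
    \bigcup_q [set x | f (rat_point q) + edist x (rat_point q) < c].
  apply/seteqP; split => x /=; rewrite in_itv/=.
    (* Half the gap, because moving from [x] to [q] costs the distance twice: in [f q] and in the
       cone. *)
    move=> fxc; have [] := @rat_point_dense x ((c - f x) / 2); first by lra.
    move=> q xq; exists q => //=.
    have := fL (rat_point q) x; rewrite edistC; lra.
  by move=> [q _ /=]; exact: le_lt_trans.
apply: countable_bigcupT_measurable => // q.
rewrite [X in measurable X](_ : _ =
  setT `&` (fun x => f (rat_point q) + edist x (rat_point q)) @^-1` `]-oo, c[%classic).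
  apply: measurable_funD => //.
  apply: (@measurableT_comp _ _ _ _ _ _ (@Num.sqrt R)).
    exact: continuous_measurable_fun (@sqrt_continuous R).
  by apply: measurable_sqdistn => //; exact: measurable_cst.
by apply/seteqP; split => x /=; rewrite in_itv/=; [move=> ?; split|case].
Qed.

(** Truncation makes the distance a bounded test function. *)
Definition dist_to (A : set V) (r : R) (x : V) : R :=
  Num.min (inf [set edist x y | y in A]) r.

Lemma dist_to_lipschitz A r x y : A !=set0 ->
  dist_to A r x <= dist_to A r y + edist x y.
Proof.
move=> [x0 Ax0].
have lbA z : has_lbound [set edist z y | y in A].
  by exists 0 => _ [w _ <-]; exact: edist_ge0.
have : inf [set edist x w | w in A] - edist x y <= inf [set edist y w | w in A].
  apply: lb_le_inf; first by exists (edist y x0), x0.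
  move=> _ [w Aw <-]; rewrite lerBlDr.
  have : inf [set edist x w | w in A] <= edist x w by apply: ge_inf => //; exists w.
  by have := edist_triangle y x w; lra.
rewrite -lerBlDr /dist_to; set I := inf _; set J := inf _ => IJ.
have := edist_ge0 x y; have : Num.min I r <= I by rewrite ge_min lexx.
have : Num.min I r <= r by rewrite ge_min lexx orbT.
by rewrite le_min => ? ? ?; apply/andP; split; lra.
Qed.

Lemma dist_to_in A r x : 0 <= r -> A x -> dist_to A r x = 0.
Proof.
move=> r0 Ax; rewrite /dist_to (_ : inf _ = 0); first by rewrite min_l.
apply/eqP; rewrite eq_le; apply/andP; split.
  rewrite -(edistxx x); apply: ge_inf; last by exists x.
  by exists 0 => _ [w _ <-]; exact: edist_ge0.
apply: lb_le_inf; first by exists (edist x x), x.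
by move=> _ [w _ <-]; exact: edist_ge0.
Qed.

Lemma dist_to_out A r x : 0 <= r -> A !=set0 ->
  (forall y, A y -> r ^+ 2 < sqdistn x y) -> dist_to A r x = r.
Proof.
move=> r0 [x0 Ax0] Ax; apply/min_idPr; apply: lb_le_inf.
  by exists (edist x x0), x0.
move=> _ [w /Ax + <-]; rewrite -sqr_edist => /ltW.
by rewrite ler_pXn2r ?nnegrE ?edist_ge0.
Qed.

Lemma dist_to_itv A r x : 0 <= r -> A !=set0 -> 0 <= dist_to A r x <= r.
Proof.
move=> r0 [x0 Ax0]; rewrite ge_min lexx orbT andbT le_min r0 andbT.
apply: lb_le_inf; first by exists (edist x x0), x0.
by move=> _ [w _ <-]; exact: edist_ge0.
Qed.

(** [B] stands for the complement of a measurable set containing the enlargement of [A], which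
    itself may fail to be measurable. *)
Lemma inf_conv_concentration (a r : R) (P : probability V R) (A B : set V) :
  0 < a -> inf_conv_ineq (@sqdistn R d n) a P ->
  measurable A -> measurable B -> ((1 / 2)%:E <= P A)%E ->
  Num.sqrt (ln 2 / a) <= r ->
  (forall x z, A x -> B z -> r ^+ 2 < sqdistn z x) ->
  (P B <= (expR (- a * (r - Num.sqrt (ln 2 / a)) ^+ 2))%:E)%E.
Proof.
move=> a0 HP mA mB PA; set r0 := Num.sqrt _ => r0r AB.
have r00 : 0 <= r0 by exact: sqrtr_ge0.
have rge0 : 0 <= r by exact: le_trans r0r.
have A0 : A !=set0.
  apply/set0P; apply: contraTneq PA => ->; rewrite measure0 -ltNge lte_fin; lra.
set f := dist_to A r.
have f0r x : 0 <= f x <= r by exact: dist_to_itv.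
have fL x y : f x - f y <= edist x y.
  by rewrite lerBlDl; exact: dist_to_lipschitz.
have bf : bmf f.
  apply: bmf_bounded f0r; apply: measurable_lipschitz => x y.
  exact: dist_to_lipschitz.
set m := \int[P]_x f x.
have m0 : 0 <= m by apply: bE_ge => // x; have /andP[] := f0r x.
(* The pair [s * f - t ^+ 2 / 4], [s * f] is admissible because [t * u - t ^+ 2 / 4 <= u ^+ 2]; it
   is used with [s = t] and [s = - t]. *)
have key (s t : R) : 0 <= t -> (forall x y, s * (f x - f y) <= t * edist x y) ->
    \int[P]_x expR (a * (s * f x - t ^+ 2 / 4)) <= expR (a * (s * m)).
  move=> t0 st; have bs : bmf (fun x => s * f x) by exact: bmfZ.
  rewrite -bEZ//; apply: HP => //; first by apply: bmfB => //; exact: bmf_cst.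
  move=> x y; rewrite -sqr_edist; have := st x y.
  have := sqr_ge0 (edist x y - t / 2); nra.
(* Markov's inequality on a set where [f] is constant. *)
have indicE (D : set V) (s t k : R) : measurable D ->
    (forall x, D x -> a * (s * f x - t ^+ 2 / 4) = k) ->
    fine (P D) * expR k <= \int[P]_x expR (a * (s * f x - t ^+ 2 / 4)).
  move=> mD Dk; rewrite -bE_indic// mulrC -bEZ; last exact: bmf_indic.
  apply: le_bE.
  - by apply: bmfZ; exact: bmf_indic.
  - by apply/bmf_expR/bmfZ; apply: bmfB; [exact: bmfZ|exact: bmf_cst].
  - move=> x; rewrite indicE; case: (boolP (x \in D)) => [|_]; last first.
      by rewrite mulr0 expR_ge0.
    by rewrite inE => /Dk ->; rewrite mulr1.
have finP D : measurable D -> ((fine (P D))%:E = P D)%E.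
  by move=> mD; rewrite fineK// fin_num_measure.
(* As [f] vanishes on [A], taking [t = 2 * m] and [s = - t] gives
   [1 / 2 <= P A <= expR (- a * m ^+ 2)]. *)
have mr0 : m <= r0.
  rewrite -(@ler_pXn2r _ 2) ?nnegrE// sqr_sqrtr; last first.
    by rewrite divr_ge0 ?ln_ge0 ?ltW//; lra.
  rewrite ler_pdivlMr// -ler_expR lnK ?posrE//.
  have H1 : fine (P A) * expR (a * (- (2 * m) * 0 - (2 * m) ^+ 2 / 4)) <=
      \int[P]_x expR (a * (- (2 * m) * f x - (2 * m) ^+ 2 / 4)).
    by apply: indicE => // x Ax; rewrite /f dist_to_in.
  have H2 := key (- (2 * m)) (2 * m).
  have {}H2 := le_trans H1 (H2 _ _).
  have : fine (P A) * expR (a * (- (2 * m) * 0 - (2 * m) ^+ 2 / 4)) <=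
    expR (a * (- (2 * m) * m)).
    apply: H2 => [|x y]; first by lra.
    rewrite mulNr -mulrN opprB edistC; apply: ler_wpM2l => //; lra.
  rewrite -ler_pdivlMr ?expR_gt0// -expRN -expRD.
  rewrite (_ : _ + _ = - (m ^+ 2 * a)); last by field.
  move=> H3.
  have : 1 / 2 <= expR (- (m ^+ 2 * a)).
    by apply: le_trans H3; rewrite -lee_fin finP.
  rewrite expRN -[1 / 2]invrK lef_pV2 ?posrE ?expR_gt0//.
  by rewrite invf_div divr1.
rewrite -finP// lee_fin.
(* This minimizes the exponent [- t * (r - m) + t ^+ 2 / 4] obtained from [f = r] on [B]. *)
pose t := 2 * (r - m).
have H1 : fine (P B) * expR (a * (t * r - t ^+ 2 / 4)) <=
    \int[P]_x expR (a * (t * f x - t ^+ 2 / 4)).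
  apply: indicE => // x Bx; rewrite /f dist_to_out// => y Ay; exact: AB.
have := le_trans H1 (key t t _ _).
rewrite -ler_pdivlMr ?expR_gt0// -expRN -expRD => H.
have {}H : fine (P B) <= expR (a * (t * m) - a * (t * r - t ^+ 2 / 4)).
  apply: H => [|x y]; first by rewrite /t; lra.
  by apply: ler_wpM2l => //; rewrite /t; lra.
apply: le_trans H _.
rewrite ler_expR (_ : _ - _ = - a * (r - m) ^+ 2); last by rewrite /t; field.
rewrite !mulNr lerN2; apply: ler_wpM2l; first exact: ltW.
by rewrite ler_pXn2r ?nnegrE//; lra.
Qed.

End concentration.

Lemma transport_entropy_concentration (R : realType) (d : nat)
  (mu : probability (d.-tuple R) R) (a : R) : 0 < a ->
  inf_conv_ineq (@sqdist R d) a mu ->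
  exists ro b : R, 0 <= ro /\ 0 <= b /\
     forall n : nat, (0 < n)%N ->
     forall P : probability (n.-tuple (d.-tuple R)) R,
       is_product_measure mu P ->
     forall A : set (n.-tuple (d.-tuple R)), measurable A ->
       ((1 / 2)%:E <= P A)%E ->
     forall r : R, ro <= r ->
       ((1 - b * expR (- a * (r - ro) ^+ 2))%:E <= outer P (enlargement A r))%E.
Proof.
move=> a0 Hmu; exists (Num.sqrt (ln 2 / a)), 1; split; first exact: sqrtr_ge0.
split=> // n _ P PE A mA PA r r0r; rewrite mul1r.
(* The bound is proved for each measurable superset [B] of the enlargement; points outside [B] are
   farther than [r] from [A]. *)
apply: le_ereal_inf_tmp => _ [B [mB AB] <-].
have mBC : measurable (~` B) by exact: measurableC.
rewrite -[B]setCK probability_setC// EFinB leeB//.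
apply: (inf_conv_concentration a0 _ mA mBC PA) => //.
  exact: inf_conv_ineq_tensor Hmu PE.
move=> x z Ax Bz; rewrite ltNge; apply/negP => zx; apply: Bz; apply: AB.
by exists x.
Qed.

(** * Exponential moments from concentration *)

Definition gaussian_concentration (R : realType) (d : nat) (a ro b : R)
  (mu : probability (d.-tuple R) R) :=
  forall n : nat, (0 < n)%N ->
  forall P : probability (n.-tuple (d.-tuple R)) R, is_product_measure mu P ->
  forall A : set (n.-tuple (d.-tuple R)), measurable A -> ((1 / 2)%:E <= P A)%E ->
  forall r : R, ro <= r ->
    ((1 - b * expR (- a * (r - ro) ^+ 2))%:E <= outer P (enlargement A r))%E.

Lemma measurable_le_cst dT (T : measurableType dT) (R : realType) (f : T -> R) k :
  measurable_fun setT f -> measurable [set x | f x <= k].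
Proof.
move=> mf; rewrite [X in measurable X](_ : _ = setT `&` f @^-1` `]-oo, k]%classic).
  exact: mf.
by apply/seteqP; split => x /=; rewrite in_itv/=; [move=> ?; split|case].
Qed.

Lemma measurable_gt_cst dT (T : measurableType dT) (R : realType) (f : T -> R) k :
  measurable_fun setT f -> measurable [set x | k < f x].
Proof.
move=> mf; rewrite (_ : [set _ | _] = ~` [set x | f x <= k]).
  exact/measurableC/measurable_le_cst.
by apply/seteqP; split => x /=; rewrite ltNge => /negP.
Qed.

Section exponential_moment.
Context (R : realType).

Lemma geometric_sum_le (q : R) N : 0 <= q < 1 -> \sum_(k < N) q ^+ k <= (1 - q)^-1.
Proof.
move=> /andP[q0 q1]; rewrite -[leRHS]mul1r ler_pdivlMr ?subr_gt0//.
have := subrX1 q N; rewrite -[X in _ = X]opprK -mulNr opprB => /eqP.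
rewrite -subr_eq0 opprK mulrC => /eqP H.
have := exprn_ge0 N q0; lra.
Qed.

(** A discrete layer-cake bound: the layer [k < y <= k.+1] containing [y] suffices by itself, and
    the term 1 covers [y <= 0]. *)
Lemma expR_le_layers (c y : R) N : 0 < c -> y <= N%:R ->
  expR (c * y) <= 1 + \sum_(k < N) expR (c * k.+1%:R) * (k%:R < y)%R%:R.
Proof.
move=> c0; elim: N => [y0|N IH yN].
  by rewrite big_ord0 addr0 -[leRHS]expR0 ler_expR; move: y0; rewrite pmulr_rle0.
rewrite big_ord_recr/=; have [Ny|/IH Ny] := ltP N%:R y; last by rewrite mulr0 addr0.
rewrite mulr1 addrA; apply: ler_wpDl.
  by rewrite addr_ge0// sumr_ge0// => k _; rewrite mulr_ge0// expR_ge0.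
by rewrite ler_expR ler_pM2l.
Qed.

(** The expected layers are dominated by a geometric series of ratio [expR (c - c')]. *)
Lemma expR_moment_le dT (T : measurableType dT) (P : probability T R) (y : T -> R)
    (c c' K : R) : 0 < c -> c < c' -> 0 <= K -> bmf y ->
  (forall u, 0 <= u -> (P [set x | (u < y x)%R] <= (K * expR (- c' * u))%:E)%E) ->
  \int[P]_x expR (c * y x) <= 1 + expR c * K * (1 - expR (c - c'))^-1.
Proof.
move=> c0 cc' K0 by_ tail; have [my [M yM]] := by_.
(* The bound on [y] only fixes the number of layers; the final estimate is uniform in [N]. *)
have [N yN] : exists N : nat, forall x, y x <= N%:R.
  exists (Num.truncn M).+1 => x; apply: le_trans (ltW (truncnS_gt _)).
  exact: le_trans (ler_norm _) (yM x).
have b1 (k : nat) : bmf (fun x => (k%:R < y x)%R%:R : R).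
  rewrite (_ : (fun x => _) = \1_[set x | k%:R < y x] :> (T -> R)).
    exact/bmf_indic/measurable_gt_cst.
  by apply/funext => x; rewrite indicE mem_setE.
have bk (k : nat) : bmf (fun x => expR (c * k.+1%:R) * (k%:R < y x)%R%:R).
  exact: bmfZ.
apply: (@le_trans _ _ (\int[P]_x
    (1 + \sum_(k < N) expR (c * k.+1%:R) * (k%:R < y x)%R%:R))).
  apply: le_bE => [||x]; last exact: expR_le_layers.
    exact/bmf_expR/bmfZ.
  by apply: bmfD; [exact: bmf_cst|apply: bmf_sum => k; exact: bk].
rewrite bED; [|exact: bmf_cst|by apply: bmf_sum => k; exact: bk].
rewrite bE_cst lerD2l bE_sum; last by move=> k; exact: bk.
have q01 : 0 <= expR (c - c') < 1 by rewrite expR_ge0 expR_lt1 subr_lt0.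
apply: le_trans (ler_wpM2l _ (geometric_sum_le N q01)); last first.
  by rewrite mulr_ge0// expR_ge0.
rewrite mulr_sumr; apply: ler_sum => k _; rewrite bEZ//.
have : \int[P]_x (k%:R < y x)%R%:R <= K * expR (- c' * k%:R).
  rewrite -lee_fin; apply: le_trans (tail k%:R (ler0n _ _)).
  rewrite -bE_indic; last exact: measurable_gt_cst.
  rewrite lee_fin (_ : (fun x => _) = \1_[set x | k%:R < y x] :> (T -> R))//.
  by apply/funext => x; rewrite indicE mem_setE.
move=> /(ler_wpM2l (expR_ge0 (c * k.+1%:R))) /le_trans; apply.
rewrite -expRM_natr mulrCA -expRD -mulrA [leRHS]mulrCA -expRD.
by rewrite ler_wpM2l// ler_expR -natr1; lra.
Qed.

End exponential_moment.

(** Completing the square: lowering the rate from [a] to [c] absorbs the shift [ro] into a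
    constant. *)
Lemma shifted_parabola_ge (R : realType) (a c ro s : R) : 0 <= c < a ->
  c * s ^+ 2 - a ^+ 2 * ro ^+ 2 / (a - c) <= a * (s - ro) ^+ 2.
Proof.
move=> /andP[c0 ca]; have ac : 0 < a - c by lra.
have -> : c * s ^+ 2 - a ^+ 2 * ro ^+ 2 / (a - c) = a * (s - ro) ^+ 2 -
    (((a - c) * s - a * ro) ^+ 2 / (a - c) + a * ro ^+ 2).
  by field; rewrite gt_eqF.
rewrite gerBl addr_ge0//; first by rewrite mulr_ge0 ?sqr_ge0// invr_ge0 ltW.
by rewrite mulr_ge0 ?sqr_ge0//; lra.
Qed.

Section concentration_to_moment.
Context (R : realType) (d : nat).
Local Notation T := (d.-tuple R).
Context (a ro b : R) (mu : probability T R).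
Context (ro0 : 0 <= ro) (b0 : 0 <= b) (conc : gaussian_concentration a ro b mu).

(** The sublevel set of [y] at [s ^+ 2] is a measurable superset of the enlargement of [A], so the
    outer measure gives way to [P]. *)
Lemma concentration_tail n (P : probability (n.-tuple T) R) (A : set (n.-tuple T))
    (y : n.-tuple T -> R) (s : R) : (0 < n)%N -> is_product_measure mu P ->
  measurable A -> ((1 / 2)%:E <= P A)%E -> measurable_fun setT y ->
  (forall x z, A x -> y z <= sqdistn z x) -> ro <= s ->
  (P [set x | (s ^+ 2 < y x)%R] <= (b * expR (- a * (s - ro) ^+ 2))%:E)%E.
Proof.
move=> n0 PE mA PA my yA ros; have mB := measurable_le_cst (s ^+ 2) my.
have -> : [set x | s ^+ 2 < y x] = ~` [set x | y x <= s ^+ 2].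
  by apply/seteqP; split => x /=; rewrite ltNge => /negP.
have PB : ((1 - b * expR (- a * (s - ro) ^+ 2))%:E <= P [set x | (y x <= s ^+ 2)%R])%E.
  apply: (le_trans (conc n0 PE mA PA ros)); apply: ereal_inf_lbound.
  exists [set x | y x <= s ^+ 2] => //; split=> // z [x Ax zx] /=.
  exact: le_trans (yA _ _ Ax) zx.
rewrite probability_setC// leeBlDr; last by rewrite fin_num_measure.
by rewrite addeC -leeBlDr// -EFinB.
Qed.

(** [C] is chosen before [n]; this uniformity is what lets n-th roots remove it later. *)
Lemma concentration_moment (c : R) : 0 < c -> c < a ->
  exists2 C : R, 0 < C & forall n (P : probability (n.-tuple T) R)
      (A : set (n.-tuple T)) (y : n.-tuple T -> R),
    (0 < n)%N -> is_product_measure mu P -> measurable A ->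
    ((1 / 2)%:E <= P A)%E -> bmf y ->
    (forall x z, A x -> y z <= sqdistn z x) ->
    \int[P]_x expR (c * y x) <= C.
Proof.
(* The drop from [a] to [c'] absorbs the shift [ro]; the drop from [c'] to [c] makes the series of
   layers converge. *)
move=> c0 ca; pose c' := (a + c) / 2; have cc' : c < c' by rewrite /c'; lra.
have c'a : c' < a by rewrite /c'; lra.
have ac : 0 < a - c' by lra.
pose L := a ^+ 2 * ro ^+ 2 / (a - c').
have L0 : 0 <= L.
  by apply: divr_ge0; [apply: mulr_ge0; exact: sqr_ge0|exact: ltW].
pose K := (1 + b) * expR L.
have b1 : 1 <= 1 + b by rewrite lerDl.
have K0 : 0 <= K by rewrite mulr_ge0 ?expR_ge0// addr_ge0.
exists (1 + expR c * K * (1 - expR (c - c'))^-1).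
  apply: ltr_pwDl => //; apply: divr_ge0.
    by apply: mulr_ge0 => //; exact: expR_ge0.
  by rewrite subr_ge0 ltW// expR_lt1 subr_lt0.
move=> n P A y n0 PE mA PA by_ yA; apply: expR_moment_le => // u u0.
have [my _] := by_; rewrite -(sqr_sqrtr u0); set s := Num.sqrt u.
have s0 : 0 <= s by exact: sqrtr_ge0.
have [ros|sro] := leP ro s.
  apply: le_trans (concentration_tail n0 PE mA PA my yA ros) _.
  rewrite lee_fin /K -mulrA -expRD; apply: ler_pM => //; first by rewrite lerDr.
  have := @shifted_parabola_ge _ a c' ro s; rewrite ler_expR -/L.
  by move=> H; have := H _; rewrite c'a andbT; lra.
(* For [s < ro] concentration is silent, but [c' * s ^+ 2 <= a * ro ^+ 2 <= L] makes the claimed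
   bound at least 1; hence the [1 + b] in [K]. *)
apply: le_trans (probability_le1 _ (measurable_gt_cst _ my)) _.
rewrite lee_fin /K -mulrA -expRD.
have : 1 <= expR (L + - c' * s ^+ 2).
  rewrite -[leLHS]expR0 ler_expR mulNr subr_ge0.
  apply: (@le_trans _ _ (a * ro ^+ 2)).
    by apply: ler_pM; rewrite ?sqr_ge0//; [lra|lra|rewrite ler_pXn2r ?nnegrE// ltW].
  rewrite /L ler_pdivlMr//.
  have -> : a * ro ^+ 2 * (a - c') = a ^+ 2 * ro ^+ 2 - c' * a * ro ^+ 2 by ring.
  by rewrite gerBl; apply: mulr_ge0; [apply: mulr_ge0; lra|exact: sqr_ge0].
move=> e1; apply: le_trans e1 _; apply: ler_peMl; first exact: expR_ge0.
by [].
Qed.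

End concentration_to_moment.

(** * Two elementary real inequalities *)

Section real_bounds.
Context (R : realType).

(** [expR x <= (1 - x)^-1], and [(1 - x) * (1 + x + 2 * x ^+ 2) = 1 + x ^+ 2 * (1 - 2 * x)]. *)
Lemma expR_le_quadratic (x : R) : x <= 1 / 2 -> expR x <= 1 + x + 2 * x ^+ 2.
Proof.
move=> x2; have x1 : 0 < 1 - x by lra.
have : expR x <= (1 - x)^-1.
  rewrite -[x in leLHS]opprK expRN lef_pV2 ?posrE ?expR_gt0//.
  by have := expR_ge1Dx (- x); lra.
move=> /le_trans; apply; rewrite -[leLHS]mul1r ler_pdivrMr//.
have : 0 <= x ^+ 2 * (1 - 2 * x) by apply: mulr_ge0; [exact: sqr_ge0|lra].
by nra.
Qed.

(** Otherwise [(x / y) ^+ n >= 1 + n * ln (x / y)] would exceed [C] for large [n]. *)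
Lemma le_of_exprn_le (x y C : R) N : 0 < x -> 0 < y ->
  (forall n, (N <= n)%N -> x ^+ n <= C * y ^+ n) -> x <= y.
Proof.
move=> x0 y0 H; rewrite leNgt; apply/negP => yx.
have r0 : 0 < x / y by rewrite divr_gt0.
have p0 : 0 < ln (x / y) by rewrite ln_gt0// ltr_pdivlMr// mul1r.
pose n := (N + (Num.truncn (C / ln (x / y))).+1)%N.
have := H n (leq_addr _ _); rewrite -ler_pdivrMr ?exprn_gt0// -expr_div_n.
rewrite -[x / y]lnK ?posrE// -expRM_natr leNgt => /negP; apply.
apply: (@lt_le_trans _ _ (1 + ln (x / y) * n%:R)); last exact: expR_ge1Dx.
apply: (@lt_le_trans _ _ (ln (x / y) * n%:R)); last by rewrite lerDr.
rewrite -ltr_pdivrMl// mulrC; apply: lt_le_trans (truncnS_gt _) _.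
by rewrite ler_nat leq_addl.
Qed.

End real_bounds.

(** * A law of large numbers for bounded functions *)

Section large_numbers.
Context (R : realType) (d : nat).
Local Notation T := (d.-tuple R).
Implicit Types mu : probability T R.

Lemma bmf_tuple_sum n (f : T -> R) : bmf f ->
  bmf (fun x : n.-tuple T => \sum_(i < n) f (tnth x i)).
Proof. by move=> bf; apply: bmf_sum => i; exact: bmf_tnth. Qed.

Lemma sum_le0_likely mu (Y : T -> R) : bmf Y -> \int[mu]_x Y x < 0 ->
  exists N, forall n, (N <= n)%N -> forall P : probability (n.-tuple T) R,
    is_product_measure mu P ->
    ((1 / 2)%:E <= P [set x | (\sum_(i < n) Y (tnth x i) <= 0)%R])%E.
Proof.
move=> bY EY; have [mY [M YM]] := bY; pose K := `|M| + 1.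
have K1 : 1 <= K by rewrite lerDr.
have YK x : `|Y x| <= K.
  by rewrite (le_trans (YM x))// (le_trans (ler_norm _))// lerDl.
set e := - \int[mu]_x Y x; have e0 : 0 < e by rewrite oppr_gt0.
have eK : e <= K.
  rewrite lerNl; apply: bE_ge => // x.
  by have := YK x; rewrite ler_norml => /andP[].
(* [l] minimizes [1 - l * e + 2 * l ^+ 2 * K ^+ 2], whose minimum is [1 - eta]. *)
pose l := e / (4 * K ^+ 2); pose eta := e ^+ 2 / (8 * K ^+ 2).
have K20 : 0 < K ^+ 2 by rewrite exprn_gt0//; lra.
have l0 : 0 < l by apply: divr_gt0 => //; exact: mulr_gt0.
have eta0 : 0 < eta.
  by apply: divr_gt0; [exact: exprn_gt0|exact: mulr_gt0].
have El : \int[mu]_x expR (l * Y x) <= expR (- eta).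
  have bound x : expR (l * Y x) <= 1 + l * Y x + 2 * l ^+ 2 * K ^+ 2.
    apply: le_trans (expR_le_quadratic _) _.
      apply: (@le_trans _ _ (l * K)).
        by apply: ler_wpM2l; [exact: ltW|exact: le_trans (ler_norm _) (YK x)].
      rewrite /l mulrAC ler_pdivrMr ?mulr_gt0//; nra.
    rewrite lerD2l exprMn mulrA; apply: ler_wpM2l.
      by rewrite mulr_ge0// sqr_ge0.
    by rewrite -(@real_normK _ (Y x)) ?num_real// ler_pXn2r ?nnegrE//; lra.
  have b1 : bmf (fun x => 1 + l * Y x) by apply: bmfD; [exact: bmf_cst|exact: bmfZ].
  apply: (@le_trans _ _ (\int[mu]_x (1 + l * Y x + 2 * l ^+ 2 * K ^+ 2))).
    apply: le_bE => //; first exact/bmf_expR/bmfZ.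
    by apply: bmfD => //; exact: bmf_cst.
  rewrite bED//; last exact: bmf_cst.
  rewrite bED; [rewrite bEZ//|exact: bmf_cst|exact: bmfZ].
  rewrite !bE_cst; apply: le_trans (expR_ge1Dx _).
  rewrite -/e -[\int[mu]_x Y x]opprK -/e /l /eta.
  rewrite [leLHS](_ : _ = 1 + - (e ^+ 2 / (8 * K ^+ 2)))//.
  by field; rewrite gt_eqF//; lra.
(* From here on [eta * n >= 1], so [expR (- eta * n) <= 1 / (1 + eta * n) <= 1 / 2]. *)
exists (Num.truncn eta^-1).+1 => n Nn P PE.
have bS : bmf (fun x : n.-tuple T => \sum_(i < n) Y (tnth x i)) by exact: bmf_tuple_sum.
have [mS _] := bS.
set A := [set x | _]; have mA : measurable A by exact: measurable_le_cst.
have mAC : measurable (~` A) by exact: measurableC.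
suff PAC : (P (~` A) <= (1 / 2)%:E)%E.
  rewrite -[A]setCK probability_setC//.
  rewrite (_ : 1 / 2 = 1 - 1 / 2 :> R); last by field.
  by rewrite EFinB leeB.
rewrite -bE_indic// lee_fin.
apply: (@le_trans _ _ (\int[P]_x expR (\sum_(i < n) l * Y (tnth x i)))).
  apply: le_bE; first exact: bmf_indic.
    apply/bmf_expR; under eq_fun do rewrite -mulr_sumr.
    exact: bmfZ.
  move=> x; rewrite indicE; case: (boolP (x \in _)) => [|_]; last exact: expR_ge0.
  rewrite inE /A /= => /negP; rewrite -ltNge => S0.
  rewrite -mulr_sumr -[leLHS]expR0 ler_expR; exact: mulr_ge0 (ltW l0) (ltW S0).
rewrite (bE_product_expR PE (bmfZ l bY)).
apply: (@le_trans _ _ (expR (- eta) ^+ n)).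
  apply: lerXn2r; rewrite ?nnegrE ?expR_ge0// ltW//.
  by apply: bE_expR_gt0; exact: bmfZ.
rewrite -expRM_natr mulNr expRN -[leRHS]invrK lef_pV2 ?posrE ?expR_gt0//.
apply: le_trans (expR_ge1Dx _).
have : 1 <= eta * n%:R.
  rewrite -ler_pdivrMl// mulr1; apply: le_trans (ltW (truncnS_gt _)) _.
  by rewrite ler_nat.
by rewrite invf_div divr1; lra.
Qed.

End large_numbers.

(** * The dual inequality and second moments from concentration *)

Section concentration_to_inf_conv.
Context (R : realType) (d : nat).
Local Notation T := (d.-tuple R).
Context (a ro b : R) (mu : probability T R).
Context (ro0 : 0 <= ro) (b0 : 0 <= b) (conc : gaussian_concentration a ro b mu).

Lemma concentration_inf_conv c : 0 < c -> c < a -> inf_conv_ineq (@sqdist R d) c mu.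
Proof.
move=> c0 ca psi phi bpsi bphi psiphi.
have [C C0 HC] := concentration_moment ro0 b0 conc c0 ca.
set m := \int[mu]_x phi x.
have epos : 0 < \int[mu]_x expR (c * psi x) by apply: bE_expR_gt0; exact: bmfZ.
suff H e : 0 < e -> \int[mu]_x expR (c * psi x) <= expR (c * (m + e)).
  rewrite -[leLHS]lnK ?posrE// ler_expR -ler_pdivrMl//.
  (* The slack [e] is needed to give [Y] below a strictly negative mean. *)
  apply/ler_addgt0Pr => e /H; rewrite -[leLHS]lnK ?posrE// ler_expR.
  by rewrite -ler_pdivrMl.
move=> e0; pose Y x := phi x - (m + e).
have bY : bmf Y by apply: bmfB => //; exact: bmf_cst.
have EY : \int[mu]_x Y x < 0.
  by rewrite bEB//; [rewrite bE_cst -/m; lra|exact: bmf_cst].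
have [N HN] := sum_le0_likely bY EY.
(* [N.+1] rather than [N] ensures [n > 0], as concentration requires. *)
apply: (@le_of_exprn_le _ _ _ C N.+1) => //; first exact: expR_gt0.
move=> n Nn; have n0 : (0 < n)%N by exact: leq_ltn_trans Nn.
have [P PE] := product_measure_exists mu n.
rewrite -(bE_product_expR PE (bmfZ c bpsi)).
pose y (x : n.-tuple T) := \sum_(i < n) (psi (tnth x i) - (m + e)).
have bpe : bmf (fun x => psi x - (m + e)) by apply: bmfB => //; exact: bmf_cst.
have by_ : bmf y by exact: bmf_tuple_sum n _ bpe.
have := HC _ P _ y n0 PE _ (HN _ (ltnW Nn) P PE) by_ _.
have -> : \int[P]_x expR (\sum_(i < n) c * psi (tnth x i)) =
   expR (c * (m + e)) ^+ n * \int[P]_x expR (c * y x).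
  rewrite -bEZ; last exact/bmf_expR/bmfZ.
  apply: eq_Rintegral => x _; rewrite -expRM_natr -expRD; congr expR.
  by rewrite /y sumrB sumr_const card_ord -mulr_sumr -mulr_natr; ring.
move=> H; rewrite mulrC ler_wpM2r ?exprn_ge0 ?expR_ge0//; apply: H.
- by apply: measurable_le_cst; case: (bmf_tuple_sum n bY).
- move=> x z /= xA.
  (* On the chosen set the sum of [Y] is nonpositive; once it is subtracted, the bound holds
     coordinate by coordinate. *)
  apply: (@le_trans _ _ (y z - \sum_(i < n) Y (tnth x i))).
    by rewrite lerBrDr gerDl.
  rewrite /y /Y -sumrB /sqdistn; apply: ler_sum => i _.
  by have := psiphi (tnth z i) (tnth x i); lra.
Qed.

Definition sqnorm (x : T) : R := sqdist x [tuple 0 | _ < d].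

Lemma measurable_sqnorm : measurable_fun setT sqnorm.
Proof. by apply: measurable_sqdist => //; exact: measurable_cst. Qed.

Lemma sqnorm_ge0 x : 0 <= sqnorm x.
Proof. exact: sqdist_ge0. Qed.

Lemma sqnorm_le x z : sqnorm z <= 2 * sqnorm x + 2 * sqdist z x.
Proof.
rewrite /sqnorm /sqdist 2!mulr_sumr -big_split; apply: ler_sum => j _ /=.
set p := tnth x j; set q := tnth z j; set r := tnth _ j.
by have := sqr_ge0 ((q - p) - (p - r)); nra.
Qed.

Lemma bmf_min_sqnorm K : 0 <= K -> bmf (fun x => Num.min (sqnorm x) K).
Proof.
move=> K0; apply: (@bmf_bounded _ _ _ _ 0 K) => [|x].
  by apply: measurable_minr => //; exact: measurable_sqnorm.
by rewrite ge_min lexx orbT le_min sqnorm_ge0 K0.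
Qed.

(** Continuity of [mu] along balls exhausting the space. *)
Lemma sqnorm_likely : exists2 rho : R, 0 <= rho &
  ((1 / 2)%:E <= mu [set x | (sqnorm x <= rho)%R])%E.
Proof.
pose F (k : nat) := [set x | sqnorm x <= k%:R].
have mF k : measurable (F k) by apply: measurable_le_cst; exact: measurable_sqnorm.
have FT : \bigcup_k F k = setT.
  apply/seteqP; split => // x _; exists (Num.truncn (sqnorm x)).+1 => //.
  exact/ltW/truncnS_gt.
have cvgF : mu (F k) @[k --> \oo] --> mu (\bigcup_k F k).
  apply: nondecreasing_cvg_mu => //; first by rewrite FT.
  by move=> k l kl; apply/subsetPset => x /= /le_trans; apply; rewrite ler_nat.
have : ((1 / 2)%:E < mu (\bigcup_k F k))%E.
  by rewrite FT [ltRHS](@probability_setT _ _ _ mu) lte_fin; lra.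
move=> /open_ereal_gt' /cvgF[k _ Hk]; exists k%:R => //.
exact/ltW/(Hk k (leqnn k)).
Qed.

(** The case [n = 1] of the moment bound, with [A] a ball of measure at least 1/2: there
    [sqnorm z / 2 - rho] is at most the squared distance from [z] to any point of [A]. *)
Lemma sqnorm_moment c : 0 < c -> c < a -> exists C : R, forall K, 0 <= K ->
  \int[mu]_x expR (c / 2 * Num.min (sqnorm x) K) <= C.
Proof.
move=> c0 ca; have [C C0 HC] := concentration_moment ro0 b0 conc c0 ca.
have [rho rho0 Hrho] := sqnorm_likely.
exists (C * expR (c * rho)) => K K0.
have bK := bmf_min_sqnorm K0.
have [P PE] := product_measure_exists mu 1%N.
pose A := [set x : 1.-tuple T | forall i, [set x | sqnorm x <= rho] (tnth x i)].
have mrho : measurable [set x | sqnorm x <= rho].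
  by apply: measurable_le_cst; exact: measurable_sqnorm.
have mA : measurable A by exact: (measurable_rectangle (fun=> mrho)).
have PA : ((1 / 2)%:E <= P A)%E.
  have := PE _ (fun=> mrho); rewrite big_ord_recl big_ord0 mule1.
  by move=> /(congr1 (fun u => (1 / 2)%:E <= u)%E) ->.
pose y (x : 1.-tuple T) := \sum_(i < 1) (1 / 2 * Num.min (sqnorm (tnth x i)) K - rho).
have bf : bmf (fun x => 1 / 2 * Num.min (sqnorm x) K - rho).
  by apply: bmfB; [exact: bmfZ|exact: bmf_cst].
have by_ : bmf y by exact: (bmf_tuple_sum 1 bf).
have := HC _ P A y (ltnSn 0) PE mA PA by_.
have -> : \int[P]_x expR (c * y x) =
    \int[mu]_x expR (c * (1 / 2 * Num.min (sqnorm x) K - rho)).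
  rewrite -[RHS]expr1 -(bE_product_expR PE (bmfZ c bf)).
  by apply: eq_Rintegral => x _; rewrite mulr_sumr.
have -> : \int[mu]_x expR (c * (1 / 2 * Num.min (sqnorm x) K - rho)) =
    expR (- (c * rho)) * \int[mu]_x expR (c / 2 * Num.min (sqnorm x) K).
  rewrite -bEZ; last exact/bmf_expR/bmfZ.
  by apply: eq_Rintegral => x _; rewrite -expRD; congr expR; ring.
rewrite expRN mulrC ler_pdivrMr ?expR_gt0//; apply => x z Ax.
rewrite /y /sqdistn !big_ord_recl !big_ord0 !addr0 lerBlDr.
have Hz : Num.min (sqnorm (tnth z ord0)) K <= sqnorm (tnth z ord0).
  by rewrite ge_min lexx.
have := sqnorm_le (tnth x ord0) (tnth z ord0); have := Ax ord0; rewrite /=; lra.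
Qed.

End concentration_to_inf_conv.

(** * Farkas' lemma and duality for finite transport problems *)

Section farkas.
Context (F : realFieldType) (V : lmodType F) (I : eqType).

Lemma scalar_comb (f : V -> F) (k : F) x y : scalar f ->
  f (x - k *: y) = f x - k * f y.
Proof. by move=> lf; rewrite addrC -scaleNr lf mulNr addrC. Qed.

(* Bartl's algebraic proof: if the constraint i0 is needed, some z satisfies all
   the others and a i0 z > 0; project along z onto the kernel of a i0. *)
Lemma farkas (s : seq I) (a : I -> V -> F) (c : V -> F) :
  uniq s -> (forall i, scalar (a i)) -> scalar c ->
  (forall x, (forall i, i \in s -> a i x <= 0) -> c x <= 0) ->
  exists2 l : I -> F, (forall i, 0 <= l i) &
    forall x, c x = \sum_(i <- s) l i * a i x.
Proof.
elim: s => [|i0 s IH] in a c * => /=.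
  move=> _ _ lc H; exists (fun=> 0) => // x; rewrite big_nil.
  apply/eqP; rewrite eq_le (H x)//= -oppr_le0.
  suff -> : - c x = c (- x) by exact: H.
  have c0 : c 0 = 0.
    by have := lc 1 0 0; rewrite scaler0 add0r mul1r => /(congr1 (fun u => u - c 0));
      rewrite subrr addrK.
  by have := scalar_comb 1 0 x lc; rewrite scale1r sub0r c0 mul1r sub0r.
move=> /andP[i0s us] la lc H.
have [Hs|] := pselect (forall x, (forall i, i \in s -> a i x <= 0) -> c x <= 0).
  have [l l0 cl] := IH a c us la lc Hs.
  exists (fun i => if i == i0 then 0 else l i) => [i|x]; first by case: ifP.
  rewrite big_cons eqxx mul0r add0r cl; apply: eq_big_seq => i is_.
  by case: eqP i0s => // <-; rewrite is_.
move=> /existsNP[z /not_implyP[za /negP]]; rewrite -ltNge => cz.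
have az : 0 < a i0 z.
  rewrite ltNge; apply/negP => az0; move: cz; rewrite ltNge (H z)// => i.
  by rewrite inE => /predU1P[->//|]; exact: za.
pose w := (a i0 z)^-1 *: z.
have lZ (f : V -> F) k x : scalar f -> f (k *: x) = k * f x.
  move=> lf; have f0 : f 0 = 0.
    by have := scalar_comb 1 x x lf; rewrite scale1r subrr mul1r subrr.
  by rewrite -[k *: x]addr0 lf f0 addr0.
have aw : a i0 w = 1 by rewrite lZ// mulVf// gt_eqF.
pose pr x := x - a i0 x *: w.
have lpr (f : V -> F) : scalar f -> scalar (fun x => f (pr x)).
  move=> lf k x y /=; rewrite /pr la !scalar_comb// lf; ring.
have [|l l0 cl] := IH (fun i x => a i (pr x)) (fun x => c (pr x)) us
    (fun i => lpr _ (la i)) (lpr _ lc).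
  move=> x Hx; apply: H => i; rewrite inE => /predU1P[->|is_]; last exact: Hx.
  by rewrite /pr scalar_comb// aw mulr1 subrr.
(* The multiplier of [i0] makes the identity hold at [w]; it is nonnegative since [c w >= 0] and the
   other constraints are nonpositive at [w]. *)
exists (fun i => if i == i0 then c w - \sum_(i <- s) l i * a i w else l i) => [i|x].
  case: ifP => // _; rewrite subr_ge0; apply: (@le_trans _ _ 0).
    rewrite big_seq; apply: sumr_le0 => j js; rewrite mulr_ge0_le0//.
    by rewrite /w lZ// mulr_ge0_le0 ?za// invr_ge0 ltW.
  by rewrite /w lZ// mulr_ge0// ?invr_ge0 ltW.
rewrite big_cons eqxx.
have := cl x; rewrite {1}/pr scalar_comb// => /eqP.
rewrite subr_eq => /eqP ->.
have -> : \sum_(i <- s) l i * a i (pr x) =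
    \sum_(i <- s) l i * a i x - a i0 x * \sum_(i <- s) l i * a i w.
  rewrite mulr_sumr -sumrB; apply: eq_bigr => i _.
  by rewrite /pr scalar_comb//; ring.
have -> : \sum_(i <- s) (if i == i0 then c w - \sum_(i1 <- s) l i1 * a i1 w
    else l i) * a i x = \sum_(i <- s) l i * a i x.
  apply: eq_big_seq => i is_.
  by case: eqP i0s => // <-; rewrite is_.
ring.
Qed.

End farkas.

(** The plan consists of the Farkas multipliers of the constraints [u i - v j <= c i j]. *)
Lemma finite_kantorovich (F : realFieldType) (I J : finType) (p : I -> F)
    (q : J -> F) (c : I -> J -> F) (K : F) :
  (forall i, 0 <= p i) -> (forall j, 0 <= q j) ->
  \sum_i p i = 1 -> \sum_j q j = 1 ->
  (forall u v, (forall i j, u i - v j <= c i j) ->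
     \sum_i p i * u i - \sum_j q j * v j <= K) ->
  exists pi : I -> J -> F, [/\ forall i j, 0 <= pi i j,
    forall i, \sum_j pi i j = p i, forall j, \sum_i pi i j = q j &
    \sum_i \sum_j pi i j * c i j <= K].
Proof.
move=> p0 q0 p1 q1 H.
(* the [None] coordinate homogenizes the affine constraints u i - v j <= c i j *)
pose V := {ffun option (I + J) -> F^o}.
pose a (o : option (I * J)) (x : V) : F :=
  if o is Some (i, j) then
    x (Some (inl i)) - x (Some (inr j)) - c i j * x None else - x None.
pose f (x : V) : F := \sum_i p i * x (Some (inl i)) - \sum_j q j * x (Some (inr j))
  - K * x None.
have la o : scalar (a o).
  by move=> k x y; case: o => [[i j]|]; rewrite /a !ffunE /GRing.scale/=; ring.
have lf : scalar f.
  move=> k x y; rewrite /f.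
  under eq_bigr do rewrite !ffunE mulrDr.
  under [X in _ - X - _]eq_bigr do rewrite !ffunE mulrDr.
  rewrite !big_split/= !ffunE /GRing.scale/=.
  under eq_bigr do rewrite mulrCA.
  under [X in _ - (X + _) - _]eq_bigr do rewrite mulrCA.
  by rewrite -!mulr_sumr; ring.
pose s : seq (option (I * J)) := None :: [seq Some ij | ij <- index_enum _].
have us : uniq s.
  rewrite /= map_inj_uniq ?index_enum_uniq ?andbT; last by move=> ? ? [].
  by apply/mapP => -[].
have Hf x : (forall o, o \in s -> a o x <= 0) -> f x <= 0.
  move=> Hx; have {}Hx o : a o x <= 0.
    apply: Hx; case: o => [ij|]; rewrite inE//=.
    by rewrite map_f// mem_index_enum.
  have t0 : 0 <= x None by have := Hx None; rewrite /a oppr_le0.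
  (* If the homogenizing coordinate is 0, all differences are nonpositive and [f x] is their average
     with weights [p i * q j]; otherwise divide by it. *)
  have [t1|t1] := ltP 0 (x None); last first.
    have t00 : x None = 0 by apply/eqP; rewrite eq_le t1.
    rewrite /f t00 mulr0 subr0.
    rewrite -[X in X - _]mul1r -[X in _ - X]mul1r -{1}q1 -p1 !mulr_suml.
    under eq_bigr do rewrite mulr_sumr.
    under [X in _ - X]eq_bigr do rewrite mulr_sumr.
    rewrite exchange_big -sumrB; apply: sumr_le0 => i _.
    rewrite -sumrB; apply: sumr_le0 => j _.
    have := Hx (Some (i, j)); rewrite /a t00 mulr0 subr0 => Hij.
    rewrite (_ : _ - _ = p i * q j * (x (Some (inl i)) - x (Some (inr j)))); last by ring.
    by apply: mulr_ge0_le0 => //; exact: mulr_ge0.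
  have := H (fun i => x (Some (inl i)) / x None) (fun j => x (Some (inr j)) / x None).
  rewrite /f subr_le0 -ler_pdivrMr// => H'.
  have {}H' := H' _; rewrite (le_trans _ (H' _))//.
    rewrite mulrBl !mulr_suml lerB// ler_sum// => i _; by rewrite mulrA.
  move=> i j; rewrite -mulrBl ler_pdivrMr// -subr_le0; exact: (Hx (Some (i, j))).
have [l l0 fl] := farkas us la lf Hf.
pose pi i j := l (Some (i, j)).
(* An identity of linear forms: coordinate vectors read off the row sums, the column sums and the
   cost. *)
have {}fl (u : I -> F) (v : J -> F) t :
    \sum_i p i * u i - \sum_j q j * v j - K * t =
    l None * - t + \sum_i \sum_j pi i j * (u i - v j - c i j * t).
  pose x : V := [ffun o => match o with
    Some (inl i) => u i | Some (inr j) => v j | None => t end].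
  transitivity (f x).
    by rewrite /f ffunE; congr (_ - _ - _); apply: eq_bigr => ? _; rewrite ffunE.
  rewrite fl big_cons big_map pair_bigA /a ffunE; congr (_ + _).
  by apply: eq_bigr => -[i j] _; rewrite !ffunE.
exists pi; split => [i j|i|j|]; first exact: l0.
- have := fl (fun k => (k == i)%:R) (fun=> 0) 0.
  rewrite (bigD1 i)//= eqxx mulr1 big1; last by move=> k /negPf ->; rewrite mulr0.
  rewrite big1; last by move=> k _; rewrite mulr0.
  rewrite mulr0 oppr0 mulr0 add0r !addr0 => ->.
  rewrite (bigD1 i)//= [X in _ + X]big1 ?addr0; last first.
    by move=> k /negPf ->; apply: big1 => j _; rewrite mulr0n; ring.
  by apply: eq_bigr => j _; rewrite eqxx mulr1n; ring.
- have := fl (fun=> 0) (fun k => (k == j)%:R) 0.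
  rewrite big1; last by move=> k _; rewrite mulr0.
  rewrite (bigD1 j)//= eqxx mulr1 big1; last by move=> k /negPf ->; rewrite mulr0.
  rewrite mulr0 oppr0 mulr0 !addr0 sub0r add0r => H1.
  apply: oppr_inj; rewrite H1 -sumrN; apply: eq_bigr => i _.
  rewrite (bigD1 j)//= [X in _ + X]big1 ?addr0; last first.
    by move=> k /negPf ->; rewrite mulr0n; ring.
  by rewrite eqxx mulr1n; ring.
(* At [u = v = 0], [t = 1] the identity says that [K] minus the cost is the multiplier [l None]. *)
- have E : \sum_i \sum_j pi i j * (0 - 0 - c i j * 1) =
      - \sum_i \sum_j pi i j * c i j.
    rewrite -sumrN; apply: eq_bigr => i _; rewrite -sumrN; apply: eq_bigr => j _.
    by ring.
  have := fl (fun=> 0) (fun=> 0) 1; rewrite E.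
  rewrite big1; last by move=> k _; rewrite mulr0.
  rewrite big1; last by move=> k _; rewrite mulr0.
  by have := l0 None; lra.
Qed.

Lemma density_probability_indic dT (T : measurableType dT) (R : realType)
  (P : probability T R) (w : T -> R) :
  bmf w -> (forall x, 0 <= w x) -> \int[P]_x w x = 1 ->
  exists Q : probability T R, forall A, measurable A ->
    Q A = (\int[P]_x (w x * \1_A x))%:E.
Proof.
move=> bw w0 w1; have [Q QE] := density_probability bw w0 w1.
exists Q => A mA; rewrite QE// EFin_bE; last exact/bmfM/bmf_indic.
rewrite integral_mkcond; apply: eq_integral => x _.
by rewrite epatch_indic EFinM.
Qed.

(** * Functions constant on the cells of a finite partition *)

Section finite_partition.
Context (R : realType) (dT : measure_display) (T : measurableType dT).
Context (I : finType) (kappa : T -> I).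
Context (mk : forall i, measurable [set x | kappa x = i]).
Local Notation cell i := [set x | kappa x = i].

Lemma bmf_cell_indic i : bmf (\1_(cell i) : T -> R).
Proof. exact: bmf_indic. Qed.

Lemma sum_cell_indic (u : I -> R) x : \sum_i u i * \1_(cell i) x = u (kappa x).
Proof.
rewrite (bigD1 (kappa x))//= indicE mem_set// mulr1 big1 ?addr0// => i ik.
by rewrite indicE memNset ?mulr0//= => ki; rewrite -ki eqxx in ik.
Qed.

Lemma bmf_cellfun (u : I -> R) : bmf (fun x => u (kappa x)).
Proof.
under eq_fun do rewrite -sum_cell_indic.
by apply: bmf_sum => i; apply: bmfZ; exact: bmf_cell_indic.
Qed.

Lemma bE_cellfun (P : probability T R) (f : T -> R) (u : I -> R) : bmf f ->
  \int[P]_x (f x * u (kappa x)) = \sum_i u i * \int[P]_x (f x * \1_(cell i) x).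
Proof.
move=> bf; have bfi i : bmf (fun x => f x * \1_(cell i) x).
  by apply: bmfM => //; exact: bmf_cell_indic.
transitivity (\int[P]_x \sum_i u i * (f x * \1_(cell i) x)).
  apply: eq_Rintegral => x _; rewrite -sum_cell_indic mulr_sumr.
  by apply: eq_bigr => i _; rewrite mulrCA.
rewrite bE_sum => [|i]; last exact: bmfZ.
by apply: eq_bigr => i _; rewrite bEZ.
Qed.

Lemma bE_cell (P : probability T R) (u : I -> R) :
  \int[P]_x u (kappa x) = \sum_i u i * \int[P]_x \1_(cell i) x.
Proof.
transitivity (\int[P]_x (1 * u (kappa x))).
  by apply: eq_Rintegral => x _; rewrite mul1r.
rewrite bE_cellfun; last exact: bmf_cst.
by apply: eq_bigr => i _; congr (_ * _); apply: eq_Rintegral => x _; rewrite mul1r.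
Qed.

End finite_partition.

(** * Couplings built from a finite transport plan *)

Section cell_coupling.
Context (R : realType) (d : nat).
Local Notation T := (d.-tuple R).
Context (nu mu : probability T R) (I : finType) (kappa : T -> I).
Context (mk : forall i, measurable [set x | kappa x = i]).
Local Notation cell i := [set x | kappa x = i].
Local Notation p i := (\int[nu]_x \1_(cell i) x).
Local Notation q i := (\int[mu]_x \1_(cell i) x).

Lemma cellfun2E (w : I -> I -> R) (z : T * T) :
  w (kappa z.1) (kappa z.2) =
  \sum_i \sum_j w i j * (\1_(cell i) z.1 * \1_(cell j) z.2).
Proof.
rewrite -(sum_cell_indic kappa (fun i => w i (kappa z.2)) z.1).
apply: eq_bigr => i _; rewrite -(sum_cell_indic kappa (w i) z.2) mulr_suml.
by apply: eq_bigr => j _; ring.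
Qed.

Lemma bmf_cell_indic2 i j :
  bmf (fun z : T * T => \1_(cell i) z.1 * \1_(cell j) z.2 : R).
Proof.
apply: bmfM.
  by apply: (@bmf_comp _ _ _ _ _ fst) => //; exact: bmf_cell_indic.
by apply: (@bmf_comp _ _ _ _ _ snd) => //; exact: bmf_cell_indic.
Qed.

Lemma bmf_cellfun2 (w : I -> I -> R) :
  bmf (fun z : T * T => w (kappa z.1) (kappa z.2)).
Proof.
under eq_fun do rewrite cellfun2E.
by apply: bmf_sum => i; apply: bmf_sum => j; apply: bmfZ; exact: bmf_cell_indic2.
Qed.

Lemma bE_cellfun2 (f g : T -> R) (w : I -> I -> R) : bmf f -> bmf g ->
  \int[(nu \x mu)%E]_z (f z.1 * g z.2 * w (kappa z.1) (kappa z.2)) =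
  \sum_i \sum_j w i j * (\int[nu]_x (f x * \1_(cell i) x) *
                         \int[mu]_y (g y * \1_(cell j) y)).
Proof.
move=> bf bg; rewrite bE_fubini; last first.
  by apply: bmfM; [apply: bmfM; exact: bmf_comp|exact: bmf_cellfun2].
transitivity (\int[nu]_x (f x *
    (fun i => \sum_j w i j * \int[mu]_y (g y * \1_(cell j) y)) (kappa x))).
  apply: eq_Rintegral => x _ /=; rewrite -(bE_cellfun mk)// -bEZ; last first.
    by apply: bmfM => //; exact: (bmf_cellfun mk).
  by apply: eq_Rintegral => y _; rewrite mulrA.
rewrite (bE_cellfun mk nu
  (fun i => \sum_j w i j * \int[mu]_y (g y * \1_(cell j) y)) bf).
apply: eq_bigr => i _.
by rewrite mulr_suml; apply: eq_bigr => j _; ring.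
Qed.

Lemma bE_cell_null (P : probability T R) (f : T -> R) i : bmf f ->
  \int[P]_x \1_(cell i) x = 0 -> \int[P]_x (f x * \1_(cell i) x) = 0.
Proof.
move=> bf Pi0; have [_ [M fM]] := bf.
have b1 : bmf (\1_(cell i) : T -> R) by exact: bmf_cell_indic.
have bM := bmfZ M b1.
have bfi : bmf (fun x => f x * \1_(cell i) x) by exact: bmfM.
apply/eqP; rewrite eq_le -oppr_le0; apply/andP; split.
  rewrite -[leRHS](mulr0 M) -Pi0 -bEZ//; apply: le_bE => // x.
  by apply: ler_wpM2r; [rewrite indicE|exact: le_trans (ler_norm _) (fM x)].
rewrite -[leRHS](mulr0 M) -Pi0 -bEZ// -mulN1r -bEZ//; apply: le_bE => // [|x].
  exact: bmfZ.
rewrite mulN1r -mulNr; apply: ler_wpM2r; first by rewrite indicE.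
by rewrite (le_trans _ (fM x))// -normrN ler_norm.
Qed.

(** Cellwise constant functions are test functions, so the hypothesis bounds the finite dual
    problem; the optimal mass of each pair of cells is then spread proportionally to [nu \x mu]. *)
Lemma cell_coupling (c : I -> I -> R) (K : R) :
  (forall x y, c (kappa x) (kappa y) <= sqdist x y) ->
  (forall psi phi, bmf psi -> bmf phi ->
     (forall x y, psi x - phi y <= sqdist x y) ->
     \int[nu]_x psi x - \int[mu]_x phi x <= K) ->
  exists2 pi : probability (T * T)%type R, is_coupling nu mu pi &
    \int[pi]_z c (kappa z.1) (kappa z.2) <= K.
Proof.
move=> csq HK.
have p0 i : 0 <= p i by apply: bE_ge => [|x]; [exact: bmf_cell_indic|rewrite indicE].
have q0 i : 0 <= q i by apply: bE_ge => [|x]; [exact: bmf_cell_indic|rewrite indicE].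
have sum1 (P : probability T R) : \sum_i \int[P]_x \1_(cell i) x = 1.
  rewrite -[RHS](bE_cst P) (bE_cell mk P (fun=> 1)).
  by apply: eq_bigr => i _; rewrite mul1r.
have [u v uv|pi [pi0 pip piq pic]] :=
    @finite_kantorovich R I I (fun i => p i) (fun i => q i) c K p0 q0 (sum1 nu) (sum1 mu).
  under eq_bigr do rewrite mulrC.
  under [X in _ - X]eq_bigr do rewrite mulrC.
  rewrite -(bE_cell mk nu u) -(bE_cell mk mu v).
  apply: HK => [||x y]; [exact: (bmf_cellfun mk)..|].
  exact: le_trans (csq x y).
(* density of the coupling with respect to nu \x mu; where p i * q j = 0 it is
   0 and so is pi i j *)
pose w i j := pi i j / (p i * q j).
have pi_p i j : p i = 0 -> pi i j = 0.
  move=> pi_0; apply/eqP; rewrite eq_le pi0 andbT -pi_0 -pip (bigD1 j)//= lerDl.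
  exact: sumr_ge0.
have pi_q i j : q j = 0 -> pi i j = 0.
  move=> pj_0; apply/eqP; rewrite eq_le pi0 andbT -pj_0 -piq (bigD1 i)//= lerDl.
  exact: sumr_ge0.
have wp i j : w i j * (p i * q j) = pi i j.
  rewrite /w; have [/eqP|pq] := eqVneq (p i * q j) 0.
    by rewrite mulf_eq0 => /orP[/eqP/pi_p|/eqP/pi_q] ->; rewrite mul0r mul0r.
  by rewrite divfK.
have w0 i j : 0 <= w i j by rewrite divr_ge0// mulr_ge0.
have indic1 (P : probability T R) i :
    \int[P]_x ((fun=> 1) x * \1_(cell i) x) = \int[P]_x \1_(cell i) x.
  by apply: eq_Rintegral => x _; rewrite mul1r.
have marg1 (f : T -> R) : bmf f ->
    \int[(nu \x mu)%E]_z (f z.1 * 1 * w (kappa z.1) (kappa z.2)) = \int[nu]_x f x.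
  move=> bf; rewrite (bE_cellfun2 w bf (bmf_cst T 1)).
  transitivity (\sum_i 1 * \int[nu]_x (f x * \1_(cell i) x)); last first.
    rewrite -(bE_cellfun mk nu (fun=> 1) bf).
    by apply: eq_Rintegral => x _; rewrite mulr1.
  (* Over a null cell both sides vanish; otherwise multiplying by [p i] reduces the claim to the row
     sum of the plan. *)
  apply: eq_bigr => i _; have [pi_0|pi_n0] := eqVneq (p i) 0.
    by rewrite (bE_cell_null bf pi_0) mulr0 big1// => j _; rewrite mul0r mulr0.
  rewrite mul1r; apply: (mulfI pi_n0).
  rewrite mulr_sumr -{2}pip mulr_suml; apply: eq_bigr => j _.
  by rewrite -(wp i j) indic1; ring.
have marg2 (f : T -> R) : bmf f ->
    \int[(nu \x mu)%E]_z (1 * f z.2 * w (kappa z.1) (kappa z.2)) = \int[mu]_x f x.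
  move=> bf; rewrite (bE_cellfun2 w (bmf_cst T 1) bf) exchange_big.
  transitivity (\sum_i 1 * \int[mu]_x (f x * \1_(cell i) x)); last first.
    rewrite -(bE_cellfun mk mu (fun=> 1) bf).
    by apply: eq_Rintegral => x _; rewrite mulr1.
  apply: eq_bigr => i _; have [pi_0|pi_n0] := eqVneq (q i) 0.
    by rewrite (bE_cell_null bf pi_0) mulr0 big1// => j _; rewrite !mulr0.
  rewrite mul1r; apply: (mulfI pi_n0).
  rewrite mulr_sumr -{2}piq mulr_suml; apply: eq_bigr => j _.
  by rewrite -(wp j i) indic1; ring.
have bw : bmf (fun z : T * T => w (kappa z.1) (kappa z.2)) by exact: bmf_cellfun2.
have [||Q QE] := @density_probability_indic _ _ R (nu \x mu)%E _ bw.
- by [].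
- rewrite -[RHS](bE_cst nu) -(marg1 _ (bmf_cst T 1)).
  by apply: eq_Rintegral => z _; rewrite !mul1r.
have indicX (A B : set T) (z : T * T) : \1_(A `*` B) z = \1_A z.1 * \1_B z.2 :> R.
  by rewrite !indicE -natrM mulnb -in_setX.
have indicT (z : T) : \1_setT z = 1 :> R by rewrite indicE in_setT.
have cQ : is_coupling nu mu Q.
  move=> A mA; split; rewrite QE; try exact: measurableX.
    rewrite -bE_indic// -marg1; last exact: bmf_indic.
    by congr EFin; apply: eq_Rintegral => z _; rewrite indicX indicT; ring.
  rewrite -bE_indic// -marg2; last exact: bmf_indic.
  by congr EFin; apply: eq_Rintegral => z _; rewrite indicX indicT; ring.
exists Q => //; apply: le_trans pic.
have Qij i j : \int[Q]_z (\1_(cell i) z.1 * \1_(cell j) z.2) = pi i j.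
  have := QE _ (measurableX (mk i) (mk j)).
  rewrite -bE_indic; last exact: measurableX.
  move=> [H]; transitivity (\int[Q]_z \1_(cell i `*` cell j) z).
    by apply: eq_Rintegral => z _; rewrite indicX.
  rewrite H -wp.
  transitivity (\int[(nu \x mu)%E]_z (w i j * (\1_(cell i) z.1 * \1_(cell j) z.2))).
    apply: eq_Rintegral => z _; rewrite indicX !indicE.
    case: (boolP (z.1 \in _)); last by rewrite mul0r !mulr0.
    case: (boolP (z.2 \in _)); last by rewrite !mulr0.
    by rewrite !inE /= => -> ->.
  rewrite (@bEZ _ _ _ (nu \x mu)%E); last exact: bmf_cell_indic2.
  congr (_ * _); rewrite bE_fubini; last exact: bmf_cell_indic2.
  rewrite [RHS]mulrC -bEZ; last exact: bmf_cell_indic.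
  apply: eq_Rintegral => x _ /=; rewrite bEZ; last exact: bmf_cell_indic.
  by rewrite mulrC.
under eq_Rintegral do rewrite cellfun2E.
rewrite bE_sum => [|i]; last by apply: bmf_sum => j; apply: bmfZ; exact: bmf_cell_indic2.
apply: ler_sum => i _; rewrite bE_sum => [|j]; last by apply: bmfZ; exact: bmf_cell_indic2.
apply: ler_sum => j _; rewrite bEZ; last exact: bmf_cell_indic2.
by rewrite Qij mulrC.
Qed.

End cell_coupling.

(** * A grid on a cube and the discretization error of the cost *)

Section grid.
Context (R : realType) (d L M : nat).
Local Notation T := (d.-tuple R).

(** For [M > 0], indices 0 to [2 * L * M] run from [- L] to [L], which explains the successor in the
    type of [grid_cell]. *)
Definition grid_node (k : nat) : R := - L%:R + k%:R / M%:R.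

(* A point is located by the set of nodes below each coordinate; points of [box]
   in the same cell have coordinates within 1 / M of each other. *)
Definition grid_cell (x : T) : {ffun 'I_d * 'I_(2 * L * M).+1 -> bool} :=
  [ffun jk : 'I_d * 'I_(2 * L * M).+1 => grid_node jk.2 <= tnth x jk.1].

Definition box : set T := [set x | forall j, - L%:R <= tnth x j < L%:R].

Lemma measurable_box : measurable box.
Proof.
pose A (_ : 'I_d) : set R := `[- L%:R, L%:R[%classic.
rewrite (_ : box = [set x | forall j, A j (tnth x j)]).
  refine (@measurable_rectangle _ _ _ A _) => j.
  exact: measurable_itv.
by apply/seteqP; split => x bx j; have := bx j; rewrite /A /= in_itv.
Qed.

Lemma measurable_grid_cell i : measurable [set x | grid_cell x = i].
Proof.
rewrite [X in measurable X](_ : _ =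
    \bigcap_(jk in [set: 'I_d * 'I_(2 * L * M).+1])
      [set x | (grid_node jk.2 <= tnth x jk.1) = i jk]).
  apply: fin_bigcap_measurable => // -[j k] _ /=.
  have mj : measurable_fun setT (fun x : T => tnth x j) by exact: measurable_tnth.
  case: (i (j, k)).
    rewrite [X in measurable X](_ : _ =
        setT `&` (fun x : T => tnth x j) @^-1` `[grid_node k, +oo[%classic).
      exact: mj.
    by apply/seteqP; split => x /=; rewrite in_itv/= andbT; [move=> ->|case].
  rewrite [X in measurable X](_ : _ =
      setT `&` (fun x : T => tnth x j) @^-1` `]-oo, grid_node k[%classic).
    exact: mj.
  apply/seteqP; split => x /=; rewrite in_itv/= ltNge.
    by move=> ->; split.
  by move=> [_ /negbTE].
apply/seteqP; split => x /= => [<- jk _|H]; first by rewrite ffunE.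
by apply/ffunP => jk; rewrite ffunE; exact: H.
Qed.

Hypothesis M0 : (0 < M)%N.

Lemma grid_cellE x y (j : 'I_d) k : (k <= 2 * L * M)%N ->
  grid_cell x = grid_cell y ->
  (grid_node k <= tnth x j) = (grid_node k <= tnth y j).
Proof.
rewrite -ltnS => kN /ffunP/(_ (j, Ordinal kN)).
by rewrite !ffunE.
Qed.

(** The extreme nodes are [- L] and [L], so the half-open cube is a union of cells. *)
Lemma grid_cell_box x y : grid_cell x = grid_cell y -> box x -> box y.
Proof.
move=> xy bx j; have /andP[Lx xL] := bx j.
have M0' : M%:R != 0 :> R by rewrite pnatr_eq0 -lt0n.
have n0 : grid_node 0 = - L%:R by rewrite /grid_node mul0r addr0.
have nL : grid_node (2 * L * M) = L%:R.
  by rewrite /grid_node !natrM mulfK//; lra.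
apply/andP; split; first by rewrite -n0 -(grid_cellE j _ xy)// n0.
by rewrite ltNge -nL -(grid_cellE j _ xy)// nL -ltNge.
Qed.

(** The last node below the coordinate of [x] is within [1 / M] of it and also lies below that of
    [y]. *)
Lemma grid_cell_close x y (j : 'I_d) : grid_cell x = grid_cell y -> box x ->
  tnth x j - tnth y j <= M%:R^-1.
Proof.
move=> xy bx; have /andP[Lx xL] := bx j.
have M0' : 0 < M%:R :> R by rewrite ltr0n.
pose t := (tnth x j + L%:R) * M%:R; pose k := Num.truncn t.
have t0 : 0 <= t by apply: mulr_ge0; [lra|exact: ltW].
have /andP[kt tk] : k%:R <= t < k.+1%:R by exact: truncn_itv.
have kN : (k <= 2 * L * M)%N.
  rewrite -(ler_nat R); apply: (le_trans kt).
  by rewrite !natrM ler_pM2r//; lra.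
have kx : grid_node k <= tnth x j.
  by rewrite /grid_node addrC lerBlDr ler_pdivrMr.
have ky : grid_node k <= tnth y j by rewrite -(grid_cellE j kN xy).
have xk : tnth x j < grid_node k + M%:R^-1.
  rewrite /grid_node -addrA -[X in _ / _ + X]mul1r -mulrDl natr1 addrC.
  by rewrite -ltrBlDr opprK ltr_pdivlMr.
lra.
Qed.

(** In each coordinate the squares differ by a product of a factor at most [2 / M] and a factor at
    most [4 * L] in absolute value. *)
Lemma grid_cell_sqdist x x' y y' :
  grid_cell x = grid_cell x' -> grid_cell y = grid_cell y' -> box x -> box y ->
  sqdist x y <= sqdist x' y' + d%:R * (8 * L%:R / M%:R).
Proof.
move=> xx yy bx by_; have bx' := grid_cell_box xx bx.
have by' := grid_cell_box yy by_.
rewrite -[d in d%:R]card_ord mulr_natl -sumr_const -big_split.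
apply: ler_sum => j _ /=.
have := grid_cell_close j xx bx; have := grid_cell_close j (esym xx) bx'.
have := grid_cell_close j yy by_; have := grid_cell_close j (esym yy) by'.
have /andP[] := bx j; have /andP[] := bx' j; have /andP[] := by_ j; have /andP[] := by' j.
set s := tnth x j; set s' := tnth x' j; set r := tnth y j; set r' := tnth y' j.
rewrite -[_ / M%:R]/(8 * L%:R * M%:R^-1); set h := M%:R^-1; set l := L%:R.
move=> *; have h0 : 0 <= h by lra.
have l0 : 0 <= l by lra.
have H1 : (s - r) - (s' - r') <= 2 * h by lra.
have H2 : - (2 * h) <= (s - r) - (s' - r') by lra.
have H3 : (s - r) + (s' - r') <= 4 * l by lra.
have H4 : - (4 * l) <= (s - r) + (s' - r') by lra.
set A := (s - r) - (s' - r') in H1 H2; set B := (s - r) + (s' - r') in H3 H4.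
have -> : (s - r) ^+ 2 = (s' - r') ^+ 2 + A * B by rewrite /A /B; ring.
rewrite lerD2l; apply: (le_trans (ler_norm _)); rewrite normrM.
have -> : 8 * l * h = (2 * h) * (4 * l) by ring.
by apply: ler_pM => //; rewrite ler_norml; apply/andP.
Qed.

Definition tail_sqnorm (x : T) : R := sqnorm x * \1_(~` box) x.

Lemma measurable_tail_sqnorm : measurable_fun setT tail_sqnorm.
Proof.
apply: measurable_funM; first exact: measurable_sqnorm.
by apply/measurable_indic/measurableC; exact: measurable_box.
Qed.

Lemma tail_sqnorm_ge0 x : 0 <= tail_sqnorm x.
Proof. by rewrite mulr_ge0 ?sqnorm_ge0// indicE. Qed.

Lemma sqnormE (x : T) : sqnorm x = \sum_j tnth x j ^+ 2.
Proof. by apply: eq_bigr => j _; rewrite tnth_mktuple subr0. Qed.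

Lemma sqnorm_box x : box x -> sqnorm x <= d%:R * L%:R ^+ 2.
Proof.
move=> bx; rewrite sqnormE -[d in d%:R]card_ord mulr_natl -sumr_const.
apply: ler_sum => j _; have /andP[? ?] := bx j.
by rewrite -(@real_normK _ (tnth x j)) ?num_real// lerXn2r ?nnegrE// ler_norml; lra.
Qed.

Lemma sqnorm_notbox x : ~ box x -> L%:R ^+ 2 <= sqnorm x.
Proof.
move=> /existsNP[j /negP]; rewrite negb_and -ltNge -leNgt => xj.
rewrite sqnormE (bigD1 j)//=; apply: ler_wpDr; first by apply: sumr_ge0 => *; exact: sqr_ge0.
rewrite -(@real_normK _ (tnth x j)) ?num_real// lerXn2r ?nnegrE//.
rewrite ler_normr; case/orP: xj; lra.
Qed.

(** A point inside the cube has squared norm at most [d * L ^+ 2], hence at most [d] times that of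
    any point outside. *)
Lemma sqdist_tail x y : ~ (box x /\ box y) ->
  sqdist x y <= (2 + 2 * d%:R) * (tail_sqnorm x + tail_sqnorm y).
Proof.
move=> nxy; have d0 : 0 <= d%:R :> R by [].
have sq : sqdist x y <= 2 * sqnorm x + 2 * sqnorm y.
  rewrite !sqnormE 2!mulr_sumr -big_split; apply: ler_sum => j _ /=.
  by have := sqr_ge0 (tnth x j + tnth y j); nra.
have x0 := sqnorm_ge0 x; have y0 := sqnorm_ge0 y.
rewrite /tail_sqnorm !indicE !in_setC.
have [bx|nbx] := pselect (box x); have [by_|nby] := pselect (box y).
- by case: nxy.
- rewrite (mem_set bx) (memNset nby)/=.
  rewrite mulr0 mulr1 add0r; have := sqnorm_box bx; have := sqnorm_notbox nby.
  move=> H1 H2; have := ler_wpM2l d0 H1; lra.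
- rewrite (memNset nbx) (mem_set by_)/=.
  rewrite mulr0 mulr1 addr0; have := sqnorm_box by_; have := sqnorm_notbox nbx.
  move=> H1 H2; have := ler_wpM2l d0 H1; lra.
- rewrite (memNset nbx) (memNset nby)/= !mulr1; have := mulr_ge0 d0 x0; have := mulr_ge0 d0 y0; lra.
Qed.

End grid.

(** * Strong Kantorovich duality for the quadratic cost *)

Section kantorovich_duality.
Context (R : realType) (d : nat).
Local Notation T := (d.-tuple R).
Implicit Types nu mu P : probability T R.

(** Dominated convergence: every point eventually lies in the cube. *)
Lemma tail_sqnorm_cvg0 P : (\int[P]_x (sqnorm x)%:E < +oo)%E ->
  (\int[P]_x (tail_sqnorm L x)%:E)%E @[L --> \oo] --> 0%E.
Proof.
move=> fin.
have [|||||_ _] := @dominated_convergence _ T R P setT measurableT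
   (fun L x => (tail_sqnorm L x)%:E) (cst 0%E) (EFin \o @sqnorm R d).
- by move=> L; apply/measurable_EFinP; exact: measurable_tail_sqnorm.
- exact: measurable_cst.
- apply: aeW => x _; apply: cvg_near_cst.
  exists (Num.truncn (Num.sqrt (sqnorm x))).+1 => // L /= HL.
  have xL : Num.sqrt (sqnorm x) < L%:R.
    by apply: lt_le_trans (truncnS_gt _) _; rewrite ler_nat.
  congr EFin; rewrite /tail_sqnorm indicE in_setC.
  suff /mem_set -> : box L x by rewrite mulr0.
  apply: contrapT => /sqnorm_notbox; apply/negP; rewrite -ltNge.
  rewrite -[ltLHS]sqr_sqrtr ?sqnorm_ge0// ltrXn2r ?nnegrE ?sqrtr_ge0//.
- apply/integrableP; split; first by apply/measurable_EFinP; exact: measurable_sqnorm.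
  by under eq_integral do rewrite /= ger0_norm ?sqnorm_ge0//.
- apply: aeW => x L _ /=; rewrite lee_fin ger0_norm ?tail_sqnorm_ge0//.
  rewrite /tail_sqnorm indicE; apply: ler_piMr; first exact: sqnorm_ge0.
  by case: (_ \in _).
by rewrite integral0_eq.
Qed.

Lemma integral_coupling nu mu (pi : probability (T * T)%type R) (f : T -> \bar R) :
  is_coupling nu mu pi -> measurable_fun setT f -> (forall x, 0 <= f x)%E ->
  (\int[pi]_z f z.1 = \int[nu]_x f x)%E /\ (\int[pi]_z f z.2 = \int[mu]_x f x)%E.
Proof.
move=> cpi mf f0; split.
  rewrite -[LHS](@ge0_integral_pushforward _ _ _ _ _ fst measurable_fst pi setT f)//.
  apply: eq_measure_integral => A mA _ /=; have [<- _] := cpi A mA.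
  by congr (pi _); apply/seteqP; split => [[x y]|[x y] []].
rewrite -[LHS](@ge0_integral_pushforward _ _ _ _ _ snd measurable_snd pi setT f)//.
apply: eq_measure_integral => A mA _ /=; have [_ <-] := cpi A mA.
by congr (pi _); apply/seteqP; split => [[x y]|[x y] []].
Qed.

Lemma kantorovich_ge nu mu (K : R) :
  (\int[nu]_x (sqnorm x)%:E < +oo)%E -> (\int[mu]_x (sqnorm x)%:E < +oo)%E ->
  (forall psi phi, bmf psi -> bmf phi ->
     (forall x y, psi x - phi y <= sqdist x y) ->
     \int[nu]_x psi x - \int[mu]_x phi x <= K) ->
  (transport_cost2 nu mu <= K%:E)%E.
Proof.
move=> nu2 mu2 HK; apply/lee_addgt0Pr => e e0.
pose D : R := 2 + 2 * d%:R.
have D0 : 0 < D by rewrite /D; have : 0 <= d%:R :> R by []; lra.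
(* Two tails of this size, multiplied by [D], cost [e / 2]; the grid accounts for the other half. *)
have e4D : 0 < e / (4 * D) by rewrite divr_gt0// mulr_gt0.
have [L [nuL muL]] : exists L, (\int[nu]_x (tail_sqnorm L x)%:E <= (e / (4 * D))%:E)%E /\
    (\int[mu]_x (tail_sqnorm L x)%:E <= (e / (4 * D))%:E)%E.
  have nbe : ereal_nbhs (0%E : \bar R) (fun u => u < (e / (4 * D))%:E)%E.
    by apply: open_ereal_lt'; rewrite lte_fin.
  have [N1 _ H1] := tail_sqnorm_cvg0 nu2 nbe.
  have [N2 _ H2] := tail_sqnorm_cvg0 mu2 nbe.
  exists (N1 + N2)%N; split; apply: ltW.
    by apply: (H1 (N1 + N2)%N); exact: leq_addr.
  by apply: (H2 (N1 + N2)%N); exact: leq_addl.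
pose M := (Num.truncn (d%:R * (8 * L%:R) / (e / 2))).+1.
have ML : d%:R * (8 * L%:R / M%:R) <= e / 2.
  rewrite mulrA ler_pdivrMr ?ltr0n// [leRHS]mulrC -ler_pdivrMr ?divr_gt0//.
  exact/ltW/truncnS_gt.
pose kappa := @grid_cell R d L M.
pose S (i j : {ffun 'I_d * 'I_(2 * L * M).+1 -> bool}) :=
  [set s | exists x y, [/\ kappa x = i, kappa y = j & s = sqdist x y]].
(* The infimum over a pair of cells minorizes the cost, as [cell_coupling] requires, and inside the
   cube is within [e / 2] of it. *)
pose c i j := inf (S i j).
have S0 x y : S (kappa x) (kappa y) !=set0 by exists (sqdist x y), x, y.
have Slb i j : has_lbound (S i j).
  by exists 0 => _ [x [y [_ _ ->]]]; exact: sqdist_ge0.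
have csq x y : c (kappa x) (kappa y) <= sqdist x y.
  by apply: ge_inf => //; exists x, y.
have c0 x y : 0 <= c (kappa x) (kappa y).
  by apply: lb_le_inf => // _ [x' [y' [_ _ ->]]]; exact: sqdist_ge0.
have mk i : measurable [set x | kappa x = i] by exact: measurable_grid_cell.
have [pi cpi pic] := cell_coupling mk csq HK.
have cost x y : sqdist x y <=
    c (kappa x) (kappa y) + e / 2 + D * (tail_sqnorm L x + tail_sqnorm L y).
  have tx := tail_sqnorm_ge0 L x; have ty := tail_sqnorm_ge0 L y.
  have Dt : 0 <= D * (tail_sqnorm L x + tail_sqnorm L y).
    by apply: mulr_ge0; [exact: ltW|exact: addr_ge0].
  have [[bx by_]|/sqdist_tail] := pselect (box L x /\ box L y); last first.
    by have := c0 x y; rewrite -/D; lra.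
  suff : sqdist x y - e / 2 <= c (kappa x) (kappa y) by lra.
  apply: lb_le_inf => // _ [x' [y' [xx yy ->]]].
  have := grid_cell_sqdist (ltn0Sn _) (esym xx) (esym yy) bx by_.
  by rewrite -/M; lra.
apply: (@le_trans _ _ (\int[pi]_z (sqdist z.1 z.2)%:E)%E).
  by apply: ereal_inf_lbound; exists pi.
have bc : bmf (fun z : T * T => c (kappa z.1) (kappa z.2) + e / 2).
  by apply: bmfD; [exact: (bmf_cellfun2 mk)|exact: bmf_cst].
have mt1 : measurable_fun setT (fun z : T * T => tail_sqnorm L z.1).
  by apply: (measurableT_comp (measurable_tail_sqnorm L)).
have mt2 : measurable_fun setT (fun z : T * T => tail_sqnorm L z.2).
  by apply: (measurableT_comp (measurable_tail_sqnorm L)).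
have mt : measurable_fun setT (fun x : T => (tail_sqnorm L x)%:E).
  by apply/measurable_EFinP; exact: measurable_tail_sqnorm.
apply: (@le_trans _ _ (\int[pi]_z ((c (kappa z.1) (kappa z.2) + e / 2)%:E +
    D%:E * ((tail_sqnorm L z.1)%:E + (tail_sqnorm L z.2)%:E)))%E).
  apply: ge0_le_integral => //.
  - by move=> z _; rewrite lee_fin; exact: sqdist_ge0.
  - by apply/measurable_EFinP; exact: measurable_sqdist.
  - apply: emeasurable_funD; first by apply/measurable_EFinP; case: bc.
    by apply: measurable_funeM; apply: emeasurable_funD; exact/measurable_EFinP.
  - by move=> z _; rewrite -!EFinD lee_fin.
have [i1 _] := integral_coupling cpi mt (tail_sqnorm_ge0 L).
have [_ i2] := integral_coupling cpi mt (tail_sqnorm_ge0 L).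
rewrite ge0_integralD//; last 4 first.
- by move=> z _; rewrite lee_fin addr_ge0// ltW// divr_gt0.
- by apply/measurable_EFinP; case: bc.
- move=> z _; apply: mule_ge0; first by rewrite lee_fin ltW.
  by apply: adde_ge0; rewrite lee_fin tail_sqnorm_ge0.
- by apply: measurable_funeM; apply: emeasurable_funD; exact/measurable_EFinP.
rewrite ge0_integralZl//; last 3 first.
- by apply: emeasurable_funD; exact/measurable_EFinP.
- by move=> z _; apply: adde_ge0; rewrite lee_fin tail_sqnorm_ge0.
- by rewrite lee_fin ltW.
rewrite ge0_integralD//; last 4 first.
- by move=> z _; rewrite lee_fin tail_sqnorm_ge0.
- exact/measurable_EFinP.
- by move=> z _; rewrite lee_fin tail_sqnorm_ge0.
- exact/measurable_EFinP.
rewrite i1 i2 -(EFin_bE pi bc) bED; [|exact: (bmf_cellfun2 mk)|exact: bmf_cst].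
rewrite bE_cst; apply: (@le_trans _ _ ((K + e / 2)%:E +
    D%:E * ((e / (4 * D))%:E + (e / (4 * D))%:E))%E).
  apply: leeD; first by rewrite lee_fin lerD2r.
  by apply: lee_wpmul2l; [rewrite lee_fin ltW|exact: leeD].
rewrite -!EFinD lee_fin le_eqVlt; apply/orP; left; apply/eqP.
by field; rewrite gt_eqF.
Qed.

Lemma integral_sqnorm_le P (K : R) :
  (forall n : nat, \int[P]_x Num.min (sqnorm x) n%:R <= K) ->
  (\int[P]_x (sqnorm x)%:E <= K%:E)%E.
Proof.
move=> HK; pose g n (x : T) : \bar R := (Num.min (sqnorm x) n%:R)%:E.
have bg n : bmf (fun x : T => Num.min (sqnorm x) n%:R) by exact: bmf_min_sqnorm.
have gcvg x : g n x @[n --> \oo] --> (sqnorm x)%:E.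
  apply: cvg_near_cst; exists (Num.truncn (sqnorm x)).+1 => // n /= Hn.
  rewrite /g min_l// ltW//; apply: lt_le_trans (truncnS_gt _) _.
  by rewrite ler_nat.
have mg n : measurable_fun setT (g n) by apply/measurable_EFinP; case: (bg n).
have g0 n x : setT x -> (0 <= g n x)%E.
  by move=> _; rewrite lee_fin le_min sqnorm_ge0 ler0n.
have gnd x : setT x -> {homo g^~ x : n m / (n <= m)%N >-> (n <= m)%E}.
  move=> _ n m nm; rewrite lee_fin le_min !ge_min lexx/=.
  by rewrite [X in _ || X]ler_nat nm orbT.
rewrite (eq_integral (fun x => limn (g ^~ x))); last first.
  by move=> x _; apply/esym/cvg_lim => //; exact: gcvg.
rewrite monotone_convergence//; apply: lime_le.
  apply: ereal_nondecreasing_is_cvgn => n m nm.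
  by apply: ge0_le_integral => // x _; [exact: g0|exact: gnd].
by apply: nearW => n; rewrite -(EFin_bE P (bg n)) lee_fin.
Qed.

End kantorovich_duality.

(** * The transport inequality from concentration *)

Section concentration_to_transport.
Context (R : realType) (d : nat).
Local Notation T := (d.-tuple R).
Context (a ro b : R) (mu : probability T R).
Context (ro0 : 0 <= ro) (b0 : 0 <= b) (conc : gaussian_concentration a ro b mu).

Lemma concentration_transport_entropy (a0 : 0 < a) (nu : probability T R) :
  (transport_cost2 nu mu <= a^-1%:E * relative_entropy nu mu)%E.
Proof.
(* A finite lower bound on the entropy, which excludes the value [-oo]. *)
have Hnu0 := donsker_varadhan mu nu (bmf_cst T (0 : R)).
have ai0 : (0 < a^-1%:E :> \bar R)%E by rewrite lte_fin invr_gt0.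
case HE : (relative_entropy nu mu) => [H||]; last 2 first.
- by rewrite gt0_muley ?leey.
- by rewrite HE leeNy_eq in Hnu0.
have DV (g : T -> R) : bmf g ->
    \int[nu]_x g x <= ln (\int[mu]_x expR (g x)) + H.
  move=> bg; have := donsker_varadhan mu nu bg; rewrite HE lee_fin; lra.
have H0 : 0 <= H.
  have := DV _ (bmf_cst T (0 : R)); rewrite !bE_cst expR0 ln1 add0r; exact.
have c2 : 0 < a / 2 by lra. have ca : a / 2 < a by lra.
have [C HC] := sqnorm_moment ro0 b0 conc c2 ca.
have bm n : bmf (fun x : T => a / 2 / 2 * Num.min (sqnorm x) n%:R).
  by apply: bmfZ; exact: bmf_min_sqnorm.
have k0 : 0 < a / 2 / 2 by lra.
have mu2 : (\int[mu]_x (sqnorm x)%:E < +oo)%E.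
  apply: le_lt_trans (ltry ((a / 2 / 2)^-1 * C)); apply: integral_sqnorm_le => n.
  rewrite ler_pdivlMl// -bEZ; last exact: bmf_min_sqnorm.
  apply: le_trans (HC n%:R (ler0n _ _)); apply: le_bE => //; first exact: bmf_expR.
  by move=> x; apply: le_trans (expR_ge1Dx _); rewrite lerDr.
(* Donsker-Varadhan carries the exponential moment of [mu] over to [nu], uniformly in the
   truncation. *)
have nu2 : (\int[nu]_x (sqnorm x)%:E < +oo)%E.
  apply: le_lt_trans (ltry ((a / 2 / 2)^-1 * (ln C + H))).
  apply: integral_sqnorm_le => n.
  rewrite ler_pdivlMl// -bEZ; last exact: bmf_min_sqnorm.
  apply: (le_trans (DV _ (bm n))); rewrite lerD2r.
  have E0 := bE_expR_gt0 mu (bm n); have En := HC n%:R (ler0n _ _).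
  by rewrite ler_ln ?posrE// (lt_le_trans E0 En).
have main c : 0 < c -> c < a -> (transport_cost2 nu mu <= (c^-1 * H)%:E)%E.
  move=> c0 ca'; apply: kantorovich_ge => // psi phi bpsi bphi psiphi.
  have := concentration_inf_conv ro0 b0 conc c0 ca' bpsi bphi psiphi.
  have E0 := bE_expR_gt0 mu (bmfZ c bpsi).
  rewrite -[leLHS]lnK ?posrE// ler_expR => Hln.
  have := DV _ (bmfZ c bpsi); rewrite bEZ// ler_pdivlMl// => HD.
  rewrite mulrBr; lra.
rewrite -EFinM; apply/lee_addgt0Pr => e e0.
(* Solves [c^-1 * H = a^-1 * H + e], with [0 < c < a] when [H > 0]; for [H = 0] the rate [a / 2] is
   used instead. *)
pose c := H / (a^-1 * H + e).
have ae : 0 < a^-1 * H + e by rewrite ltr_wpDl// mulr_ge0// invr_ge0 ltW.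
have [H00|Hpos] := eqVneq H 0.
  rewrite H00 mulr0 add0e (le_trans (main _ c2 ca))// H00 mulr0 lee_fin ltW//.
have {Hpos}H1 : 0 < H by rewrite lt_neqAle eq_sym Hpos.
apply: (le_trans (main c _ _)).
- by rewrite divr_gt0.
- rewrite /c ltr_pdivrMr// mulrDr mulrA mulfV ?gt_eqF// mul1r ltrDl.
  exact: mulr_gt0.
- rewrite /c invf_div mulrVK ?unitfE ?gt_eqF//.
Qed.

End concentration_to_transport.

Theorem theorem1 (R : realType) (d : nat) (mu : probability (d.-tuple R) R)
  (a : R) (ha : 0 < a) :
  (exists ro b : R, 0 <= ro /\ 0 <= b /\
     forall n : nat, (0 < n)%N ->
     forall P : probability (n.-tuple (d.-tuple R)) R,
       is_product_measure mu P ->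
     forall A : set (n.-tuple (d.-tuple R)), measurable A ->
       ((1 / 2)%:E <= P A)%E ->
     forall r : R, ro <= r ->
       ((1 - b * expR (- a * (r - ro) ^+ 2))%:E <= outer P (enlargement A r))%E)
  <->
  (forall nu : probability (d.-tuple R) R,
     (transport_cost2 nu mu <= a^-1%:E * relative_entropy nu mu)%E).
Proof.
split=> [[ro [b [ro0 [b0 conc]]]] nu|T2].
  exact: (concentration_transport_entropy ro0 b0 conc ha).
exact/transport_entropy_concentration/transport_entropy_inf_conv.
Qed.
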